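(* Let $A$ be an Auslander regular algebra with an admissible ordering of the simple modules and with Coxeter matrix $C$. Then a Bruhat decomposition $C=U_1PU_2$ is given by $C=PU_2$ (that is, $U_1$ is the identity matrix), where $P$ corresponds to the grade bijection of $A$ and $U_2$ is upper triangular with every diagonal entry equal to $1$ or $-1$.
   Context: Algebras are finite-dimensional quiver algebras (a path algebra of a finite quiver over a field $K$ modulo an admissible ideal), with primitive idempotents $e_1,\dots,e_n$ corresponding to the vertices; modules are finitely generated right modules; $D=\operatorname{Hom}_K(-,K)$. $S(i)$ is the simple module at vertex $i$. Let $0\to A\to I^0\to I^1\to\cdots$ be a minimal injective coresolution of $A$. $A$ is Auslander--Gorenstein if $\operatorname{pdim} I^i\le i$ for all $i\ge 0$ and $\operatorname{idim} A<\infty$; it is Auslander regular if moreover it has finite global dimension. The grade of a module $S$ is $\operatorname{grade} S=\inf\{i\ge 0\mid \operatorname{Ext}_A^i(S,A)\ne 0\}$. For $A$ Auslander--Gorenstein the grade bijection on isomorphism classes of simple modules is $\phi(S)=\operatorname{top}\big(D\operatorname{Ext}_A^{g_S}(S,A)\big)$, $g_S=\operatorname{grade} S$ (known to be a well-defined bijection); the associated permutation of $\{1,\dots,n\}$ is $\hat\phi(i)=j$ when $\phi(S(i))\cong S(j)$. An ordering $S(1),\dots,S(n)$ of the simple modules is admissible if $\operatorname{grade} S(i)<\operatorname{grade} S(j)$ implies $i>j$. The Cartan matrix $\omega_A$ is the $n\times n$ matrix with $(i,j)$ entry $\dim_K e_jAe_i$. If $A$ has finite global dimension, $\omega_A$ is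 invertible over $\mathbb Z$ and the Coxeter matrix is $C=-\omega_A^T\omega_A^{-1}$. A Bruhat decomposition of an invertible real matrix $M$ is a factorisation $M=U_1PU_2$ with $P$ a permutation matrix and $U_1,U_2$ upper triangular; $P$ is uniquely determined by $M$. A permutation matrix $P$ is identified with the permutation sending $i$ to the index of the unique row having a non-zero entry in the $i$-th column. *)

(* Defs.v *)
From HB Require Import structures.
From mathcomp Require Import all_boot all_order all_fingroup all_algebra all_field.
From mathcomp Require Import finmap boolp classical_sets reals.
Set Implicit Arguments.
Unset Strict Implicit.
Unset Printing Implicit Defensive.

Import GRing.Theory.
Local Open Scope ring_scope.

(* Declaring A^c a K-algebra lets left A-modules be right A^c-modules.        *)

Section ConverseAlgebra.
Context (K : fieldType) (A : falgType K).

HB.instance Definition _ := Vector.copy A^c A.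

Fact converse_scalerAl (k : K) (x y : A^c) :
  k *: (x * y) = (k *: x : A^c) * y.
Proof. exact: (@scalerAr K A k y x). Qed.

Fact converse_scalerAr (k : K) (x y : A^c) :
  k *: (x * y) = x * (k *: y : A^c).
Proof. exact: (@scalerAl K A k y x). Qed.

HB.instance Definition _ :=
  GRing.Lmodule_isLalgebra.Build K A^c converse_scalerAl.
HB.instance Definition _ :=
  GRing.Lalgebra_isAlgebra.Build K A^c converse_scalerAr.

End ConverseAlgebra.

(* The subspace { v | P v }; it is specified by subspace_ofP, so it is only   *)
(* meaningful for P closed under linear combinations (it is 0 otherwise).     *)

Section SubspaceOf.
Context (K : fieldType) (V : vectType K).
Implicit Types (P : V -> Prop) (U : {vspace V}).

Definition subspace_of P : {vspace V} :=
  xget 0%VS [set U : {vspace V} | forall v, v \in U <-> P v]%classic.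

Definition lin_closed P :=
  P 0 /\ forall k u v, P u -> P v -> P (k *: u + v).

Lemma subspace_ofP P : lin_closed P -> forall v, v \in subspace_of P <-> P v.
Proof.
case=> P0 Plin; rewrite /subspace_of; case: xgetP => [U _ // | noU].
pose good d := exists U, (forall v, v \in U -> P v) /\ \dim U = d.
have ex_good : exists d, `[< good d >].
  exists 0%N; apply/asboolP; exists 0%VS; split; last exact: dimv0.
  by move=> v; rewrite memv0 => /eqP ->.
have good_le d : `[< good d >] -> (d <= dim V)%N.
  by move/asboolP=> [U [_ <-]]; rewrite -dimvf dimvS ?subvf.
case: (ex_maxnP ex_good good_le) => d /asboolP [U [PU dimU]] max_d.
case: (noU U) => v; split=> [/PU // | Pv].
have : `[< good (\dim (U + <[v]>)) >].
  apply/asboolP; exists (U + <[v]>)%VS; split=> // w.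
  by case/memv_addP=> u /PU Pu [_ /vlineP [k ->] ->]; rewrite addrC; apply: Plin.
move/max_d; rewrite -dimU => le_d.
have /eqP -> : (U == U + <[v]>)%VS by rewrite eqEdim addvSl.
exact: subvP (addvSr _ _) _ (memv_line v).
Qed.

End SubspaceOf.

(* Finitely generated (equivalently, finite-dimensional) right modules;       *)
(* ract M a is the map x |-> x . a.                                           *)

Section Modules.
Context (K : fieldType) (A : falgType K).

Record rmod := RMod {
  rcar :> vectType K;
  ract : A -> 'End(rcar);
  ract_lin : linear ract;
  ract1 : ract 1 = \1%VF;
  ractM : forall a b, ract (a * b) = (ract b \o ract a)%VF }.

Implicit Types M N : rmod.

Definition rhom M N (f : 'Hom(M, N)) : Prop :=
  forall a x, f (ract M a x) = ract N a (f x).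

Definition rmod_iso M N : Prop :=
  exists f : 'Hom(M, N), [/\ rhom f, lker f = 0%VS & limg f = fullv].

Definition is_submod M (U : {vspace M}) : Prop :=
  forall a x, x \in U -> ract M a x \in U.

Section Submodule.
Context (M : rmod) (U : {vspace M}) (hU : is_submod U).

Definition sub_act a : 'End(subvs_of U) :=
  (linfun (vsproj U) \o ract M a \o linfun (@vsval K M U))%VF.

Lemma sub_actE a x : vsval (sub_act a x) = ract M a (vsval x).
Proof. by rewrite !comp_lfunE !lfunE /= vsprojK ?hU ?subvsP. Qed.

Fact sub_act_lin : linear sub_act.
Proof.
move=> k a b; apply/lfunP=> x; apply: subvs_inj.
by rewrite add_lfunE scale_lfunE linearP /= !sub_actE ract_lin add_lfunE
  scale_lfunE.
Qed.

Fact sub_act1 : sub_act 1 = \1%VF.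
Proof. by apply/lfunP=> x; apply: subvs_inj; rewrite sub_actE ract1 !lfunE. Qed.

Fact sub_actM a b : sub_act (a * b) = (sub_act b \o sub_act a)%VF.
Proof.
by apply/lfunP=> x; apply: subvs_inj; rewrite comp_lfunE !sub_actE ractM lfunE.
Qed.

Definition submod : rmod := RMod sub_act_lin sub_act1 sub_actM.

End Submodule.

(* M / U is carried by the complement U^C, onto which quot_proj U projects    *)
(* along U.                                                                   *)

Definition quot_proj M (U : {vspace M}) : 'Hom(M, subvs_of U^C) :=
  (linfun (vsproj U^C) \o daddv_pi U^C U)%VF.

Section Quotient.
Context (M : rmod) (U : {vspace M}) (hU : is_submod U).

Lemma quot_proj_val x : x - vsval (quot_proj U x) \in U.
Proof.
rewrite comp_lfunE lfunE /= vsprojK ?memv_pi //.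
have def_x : daddv_pi U U^C x + daddv_pi U^C U x = x.
  apply: daddv_pi_add; first exact: capv_compl.
  by rewrite addv_complf memvf.
by rewrite -[X in X - _]def_x addrK memv_pi.
Qed.

Lemma quot_projK y : quot_proj U (vsval y) = y.
Proof.
apply: subvs_inj; rewrite comp_lfunE lfunE /= vsprojK ?memv_pi //.
by rewrite daddv_pi_id ?subvsP // capvC capv_compl.
Qed.

Lemma quot_proj0 x : (quot_proj U x == 0) = (x \in U).
Proof.
apply/eqP/idP => [qx0 | Ux].
  by have := quot_proj_val x; rewrite qx0 [X in _ - X](_ : _ = 0) ?subr0.
have : vsval (quot_proj U x) \in (U :&: U^C)%VS.
  rewrite memv_cap subvsP andbT -[vsval _](subKr x) memvB //.
  exact: quot_proj_val.
by rewrite capv_compl memv0 => /eqP q0; apply: subvs_inj; rewrite q0.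
Qed.

Definition quot_act a : 'End(subvs_of U^C) :=
  (quot_proj U \o ract M a \o linfun (@vsval K M U^C))%VF.

Lemma quot_actE a x : quot_act a (quot_proj U x) = quot_proj U (ract M a x).
Proof.
have -> y : quot_act a y = quot_proj U (ract M a (vsval y)).
  by rewrite !comp_lfunE !lfunE.
apply/eqP; rewrite -subr_eq0 -raddfB -raddfB quot_proj0; apply: hU.
by rewrite -opprB memvN quot_proj_val.
Qed.

Fact quot_act_lin : linear quot_act.
Proof.
move=> k a b; apply/lfunP=> x; rewrite -[x]quot_projK add_lfunE scale_lfunE.
by rewrite !quot_actE ract_lin add_lfunE scale_lfunE linearP.
Qed.

Fact quot_act1 : quot_act 1 = \1%VF.
Proof.
by apply/lfunP=> x; rewrite -[x]quot_projK quot_actE ract1 !id_lfunE.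
Qed.

Fact quot_actM a b : quot_act (a * b) = (quot_act b \o quot_act a)%VF.
Proof.
apply/lfunP=> x; rewrite -[x]quot_projK comp_lfunE !quot_actE.
by rewrite ractM comp_lfunE.
Qed.

Definition quotmod : rmod := RMod quot_act_lin quot_act1 quot_actM.

End Quotient.

(* The subquotient Z / (Z :&: B) of M.                                        *)

Fact subquot_fact M (Z B : {vspace M}) (hZ : is_submod Z) :
  is_submod B -> @is_submod (submod hZ) (linfun (@vsval K M Z) @^-1: B)%VS.
Proof.
have vE (y : subvs_of Z) : linfun (@vsval K M Z) y = vsval y by exact: lfunE.
by move=> hB a x; rewrite -!memv_preim !vE (sub_actE hZ); apply: hB.
Qed.

Definition subquot M (Z B : {vspace M}) (hZ : is_submod Z) (hB : is_submod B) :
  rmod := quotmod (@subquot_fact M Z B hZ hB).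

Definition max_submod M (W : {vspace M}) : Prop :=
  [/\ is_submod W, W <> fullv &
      forall W' : {vspace M},
        is_submod W' -> (W <= W')%VS -> W' = W \/ W' = fullv].

Definition rad M : {vspace M} :=
  subspace_of (fun x : M => forall W : {vspace M}, max_submod W -> x \in W).

Lemma mem_rad M x :
  x \in rad M <-> forall W : {vspace M}, max_submod W -> x \in W.
Proof.
apply: subspace_ofP; split=> [W _ | k u v Pu Pv W hW]; first exact: mem0v.
by rewrite memvD ?memvZ ?Pu ?Pv.
Qed.

Fact rad_submod M : is_submod (rad M).
Proof.
move=> a x /mem_rad radx; apply/mem_rad=> W hW; case: (hW) => subW _ _.
exact/subW/radx.
Qed.

Definition top M : rmod := quotmod (rad_submod (M := M)).

Definition projective P : Prop :=
  forall M N (g : 'Hom(M, N)) (f : 'Hom(rcar P, N)),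
    rhom g -> limg g = fullv -> @rhom P N f ->
    exists2 h : 'Hom(rcar P, M), @rhom P M h & (g \o h)%VF = f.

Definition injective_mod I : Prop :=
  forall M N (g : 'Hom(M, N)) (f : 'Hom(M, rcar I)),
    rhom g -> lker g = 0%VS -> @rhom M I f ->
    exists2 h : 'Hom(N, rcar I), @rhom N I h & (h \o g)%VF = f.

Definition proj_resolution M (P : nat -> rmod) (eps : 'Hom(P 0%N, M))
    (del : forall i, 'Hom(P i.+1, P i)) : Prop :=
  [/\ (forall i, projective (P i)),
      rhom eps /\ (forall i, rhom (del i)),
      limg eps = fullv, limg (del 0%N) = lker eps &
      forall i, limg (del i.+1) = lker (del i)].

Definition pdim_le M (d : nat) : Prop :=
  exists (P : nat -> rmod) (eps : 'Hom(P 0%N, M))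
         (del : forall i, 'Hom(P i.+1, P i)),
    proj_resolution eps del /\ forall i, (d < i)%N -> \dim {: P i} = 0%N.

Definition inj_coresolution M (I : nat -> rmod) (eta : 'Hom(M, I 0%N))
    (del : forall i, 'Hom(I i, I i.+1)) : Prop :=
  [/\ (forall i, injective_mod (I i)),
      rhom eta /\ (forall i, rhom (del i)),
      lker eta = 0%VS, limg eta = lker (del 0%N) &
      forall i, limg (del i) = lker (del i.+1)].

Definition idim_le M (d : nat) : Prop :=
  exists (I : nat -> rmod) (eta : 'Hom(M, I 0%N))
         (del : forall i, 'Hom(I i, I i.+1)),
    inj_coresolution eta del /\ forall i, (d < i)%N -> \dim {: I i} = 0%N.

Definition essential M (U : {vspace M}) : Prop :=
  forall W : {vspace M}, is_submod W -> (U :&: W)%VS = 0%VS -> W = 0%VS.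

(* Minimality: each I i is an injective envelope of the image of the map into *)
(* it, that is, that image is essential.                                      *)

Definition min_inj_coresolution M (I : nat -> rmod) (eta : 'Hom(M, I 0%N))
    (del : forall i, 'Hom(I i, I i.+1)) : Prop :=
  [/\ inj_coresolution eta del, essential (limg eta) &
      forall i, essential (limg (del i))].

Definition finite_gldim : Prop := exists d, forall M, pdim_le M d.

Definition regmod : rmod :=
  @RMod A (@amulr K A) (@amulr_is_linear K A)
    (amulr_is_monoid_morphism A).1 (amulr_is_monoid_morphism A).2.

Definition auslander_gorenstein : Prop :=
  (exists (I : nat -> rmod) (eta : 'Hom(regmod, I 0%N))
          (del : forall i, 'Hom(I i, I i.+1)),
     min_inj_coresolution eta del /\ forall i, pdim_le (I i) i)
  /\ exists d, idim_le regmod d.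

Definition auslander_regular : Prop := auslander_gorenstein /\ finite_gldim.

End Modules.

(* Ext_A^i(M, A) as a left A-module, computed from the standard free          *)
(* resolution of M: the cover of a module is the free module on a K-basis of  *)
(* it, and the resolution covers the successive syzygies (std_resolution).    *)

Section Ext.
Context (K : fieldType) (A : falgType K).
Implicit Types M P : rmod A.

Fact lker_submod M N (f : 'Hom(rcar M, rcar N)) :
  @rhom K A M N f -> is_submod (lker f).
Proof. by move=> hf a x; rewrite !memv_ker hf => /eqP ->; rewrite linear0. Qed.

Section Free.
Context (r : nat).

Definition free_actf (a : A) (f : {ffun 'I_r -> A}) : {ffun 'I_r -> A} :=
  [ffun i => f i * a].

Fact free_actf_linear a : linear (free_actf a).
Proof. by move=> k f g; apply/ffunP=> i; rewrite !ffunE mulrDl scalerAl. Qed.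

HB.instance Definition _ a :=
  GRing.isLinear.Build K _ _ _ (free_actf a) (free_actf_linear a).

Definition free_act a : 'End({ffun 'I_r -> A}) := linfun (free_actf a).

Lemma free_actE a f i : free_act a f i = f i * a.
Proof. by rewrite lfunE /= ffunE. Qed.

Fact free_act_lin : linear free_act.
Proof.
move=> k a b; apply/lfunP=> f; apply/ffunP=> i.
by rewrite add_lfunE scale_lfunE !ffunE !free_actE mulrDr scalerAr.
Qed.

Fact free_act1 : free_act 1 = \1%VF.
Proof.
by apply/lfunP=> f; apply/ffunP=> i; rewrite free_actE mulr1 id_lfunE.
Qed.

Fact free_actM a b : free_act (a * b) = (free_act b \o free_act a)%VF.
Proof.
by apply/lfunP=> f; apply/ffunP=> i; rewrite comp_lfunE !free_actE mulrA.
Qed.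

Definition freemod : rmod A := RMod free_act_lin free_act1 free_actM.

End Free.

Section Cover.
Context (M : rmod A).
Let r := \dim {: M}.

Definition coverf (f : {ffun 'I_r -> A}) : M :=
  \sum_i ract M (f i) (vbasis {: M})`_i.

Fact coverf_linear : linear coverf.
Proof.
move=> k f g; rewrite /coverf scaler_sumr -big_split /=.
by apply: eq_bigr => i _; rewrite !ffunE ract_lin add_lfunE scale_lfunE.
Qed.

HB.instance Definition _ := GRing.isLinear.Build K _ _ _ coverf coverf_linear.

Definition cover : 'Hom(freemod r, M) := linfun coverf.

Lemma cover_rhom : @rhom K A (freemod r) M cover.
Proof.
move=> a f; rewrite !lfunE /= /coverf linear_sum.
by apply: eq_bigr => i _; rewrite ffunE ractM comp_lfunE.
Qed.

Lemma limg_cover : limg cover = fullv.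
Proof.
apply/eqP; rewrite eqEsubv subvf /=; apply/subvP=> x _.
rewrite (coord_vbasis (memvf x)) memv_suml // => i _; rewrite memvZ //.
pose d : freemod r := [ffun j : 'I_r => (j == i)%:R].
suff <- : cover d = (vbasis {: M})`_i by rewrite memv_img ?memvf.
rewrite lfunE /= /coverf (bigD1 i) //= ffunE eqxx ract1 id_lfunE big1 ?addr0 //.
move=> j /negPf ji; rewrite ffunE ji.
have -> : ract M 0 = 0 by have := ract_lin M (-1) 1 1; rewrite !scaleN1r !addNr.
by rewrite zero_lfunE.
Qed.

End Cover.

Definition syzygy M : rmod A := submod (lker_submod (cover_rhom (M := M))).

Fixpoint syz (i : nat) M : rmod A :=
  if i is j.+1 then syzygy (syz j M) else M.

Definition std_term M (i : nat) : rmod A := freemod (\dim {: syz i M}).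

Definition std_diff M i : 'Hom(std_term M i.+1, std_term M i) :=
  (linfun (@vsval K _ (lker (cover (syz i M)))) \o cover (syz i.+1 M))%VF.

Lemma freemod_projective r : projective (freemod r).
Proof.
move=> M N g f hg g_onto hf.
pose e (i : 'I_r) : freemod r := [ffun j : 'I_r => (j == i)%:R : A].
pose h0 (v : {ffun 'I_r -> A}) : M :=
  \sum_i ract M (v i) ((g^-1)%VF (f (e i))).
have h0_lin : linear h0.
  move=> k u v; rewrite /h0 scaler_sumr -big_split /=.
  by apply: eq_bigr => i _; rewrite !ffunE ract_lin add_lfunE scale_lfunE.
pose h0L : {linear {ffun 'I_r -> A} -> M} :=
  HB.pack h0 (GRing.isLinear.Build K _ _ _ h0 h0_lin).
have hE v : linfun h0L v = h0 v by rewrite lfunE.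
exists (linfun h0L : 'Hom(freemod r, M)) => [a v|].
  rewrite !hE /h0 linear_sum; apply: eq_bigr => i _.
  by rewrite lfunE /= ffunE ractM comp_lfunE.
apply/lfunP=> v; rewrite comp_lfunE hE /h0 linear_sum /=.
have -> : f v = f (\sum_i ract (freemod r) (v i) (e i)).
  congr (f _); apply/ffunP=> j; rewrite sum_ffunE (bigD1 j) //= big1.
    by rewrite lfunE /= !ffunE eqxx mul1r addr0.
  by move=> i /negPf ij; rewrite lfunE /= !ffunE eq_sym ij mul0r.
rewrite linear_sum; apply: eq_bigr => i _.
by rewrite hg limg_lfunVK ?g_onto ?memvf // -hf.
Qed.

Lemma std_diffE M i x :
  std_diff M i x = vsval (cover (syz i.+1 M) x : subvs_of _).
Proof. by rewrite comp_lfunE [LHS]lfunE. Qed.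

Lemma std_diff_rhom M i : rhom (std_diff M i).
Proof.
move=> a x; rewrite !std_diffE cover_rhom.
exact: (sub_actE (lker_submod (cover_rhom (M := syz i M)))).
Qed.

Lemma limg_std_diff M i : limg (std_diff M i) = lker (cover (syz i M)).
Proof.
rewrite limg_comp limg_cover; apply/vspaceP=> x; apply/memv_imgP/idP.
  by case=> y _ ->; rewrite lfunE subvsP.
by move=> kx; exists (vsproj _ x); rewrite ?memvf // lfunE /= vsprojK.
Qed.

Lemma lker_std_diff M i : lker (std_diff M i) = lker (cover (syz i.+1 M)).
Proof.
apply/vspaceP=> x; rewrite !memv_ker std_diffE.
by apply/eqP/eqP => [h | ->]; first exact: subvs_inj.
Qed.

Lemma std_resolution M :
  @proj_resolution K A M (std_term M) (cover M) (std_diff M).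
Proof.
split=> [i || | | i]; first exact: freemod_projective.
- by split=> [|i]; [exact: cover_rhom | exact: std_diff_rhom].
- exact: limg_cover.
- exact: limg_std_diff.
- by rewrite limg_std_diff lker_std_diff.
Qed.

(* The left A-module Hom_K(P, A), with (a f)(x) = a f(x).                     *)

Section HomMod.
Context (P : rmod A).

Definition lpostf (a : A) (f : 'Hom(P, A)) : 'Hom(P, A) := (amull a \o f)%VF.

Fact lpostf_linear a : linear (lpostf a).
Proof. by move=> k f g; rewrite /lpostf comp_lfunDr -comp_lfunZr. Qed.

HB.instance Definition _ a :=
  GRing.isLinear.Build K _ _ _ (lpostf a) (lpostf_linear a).

Definition hom_act (a : A^c) : 'End('Hom(P, A)) := linfun (lpostf a).

Lemma hom_actE (a : A) f : hom_act a f = (amull a \o f)%VF.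
Proof. by rewrite lfunE. Qed.

Fact hom_act_lin : linear hom_act.
Proof.
move=> k a b; apply/lfunP=> f; rewrite add_lfunE scale_lfunE !hom_actE.
by rewrite linearP comp_lfunDl -comp_lfunZl.
Qed.

Fact hom_act1 : hom_act 1 = \1%VF.
Proof.
by apply/lfunP=> f; rewrite hom_actE amull1 comp_lfun1l id_lfunE.
Qed.

Fact hom_actM (a b : A^c) : hom_act (a * b) = (hom_act b \o hom_act a)%VF.
Proof.
apply/lfunP=> f; rewrite comp_lfunE !hom_actE comp_lfunA.
congr (_ \o _)%VF; apply/lfunP=> x.
by rewrite comp_lfunE !lfunE /= mulrA.
Qed.

Definition hommod : rmod A^c := RMod hom_act_lin hom_act1 hom_actM.

End HomMod.

Section Cohomology.
Context (P : nat -> rmod A) (del : forall i, 'Hom(P i.+1, P i)).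

Definition cocycles i : {vspace hommod (P i)} :=
  subspace_of (fun f : 'Hom(P i, A) =>
    @rhom K A (P i) (regmod A) f /\ (f \o del i = 0)%VF).

Definition coboundaries i : {vspace hommod (P i)} :=
  if i is j.+1 then
    subspace_of (fun f : 'Hom(P j.+1, A) =>
      exists2 h : 'Hom(P j, A), @rhom K A (P j) (regmod A) h &
                                f = (h \o del j)%VF)
  else 0%VS.

Lemma mem_cocycles i (f : 'Hom(P i, A)) :
  f \in cocycles i <->
  @rhom K A (P i) (regmod A) f /\ (f \o del i = 0)%VF.
Proof.
apply: subspace_ofP; split=> [|k u v [hu du] [hv dv]].
  by split=> [a x|]; rewrite ?zero_lfunE ?linear0 // comp_lfun0l.
split=> [a x|]; last first.
  by rewrite comp_lfunDl -comp_lfunZl du dv scaler0 addr0.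
by rewrite !add_lfunE !scale_lfunE hu hv linearP.
Qed.

Lemma mem_coboundaries i (f : 'Hom(P i.+1, A)) :
  f \in coboundaries i.+1 <->
  exists2 h : 'Hom(P i, A), @rhom K A (P i) (regmod A) h &
                            f = (h \o del i)%VF.
Proof.
apply: (subspace_ofP (P := fun f : 'Hom(P i.+1, A) => _)).
split=> [|k u v [h hh ->] [h' hh' ->]].
  by exists 0; [move=> a x; rewrite !zero_lfunE linear0 | rewrite comp_lfun0l].
exists (k *: h + h'); last by rewrite comp_lfunDl -comp_lfunZl.
by move=> a x; rewrite !add_lfunE !scale_lfunE hh hh' linearP.
Qed.

Fact cocycles_submod i : @is_submod K A^c (hommod (P i)) (cocycles i).
Proof.
move=> a f /mem_cocycles [hf df]; rewrite /= hom_actE; apply/mem_cocycles.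
split=> [b x|]; last by rewrite -comp_lfunA df comp_lfun0r.
by rewrite !comp_lfunE hf !lfunE /= mulrA.
Qed.

Fact coboundaries_submod i :
  @is_submod K A^c (hommod (P i)) (coboundaries i).
Proof.
case: i => [|i] a f; first by rewrite !memv0 => /eqP ->; rewrite linear0.
move=> /mem_coboundaries [h hh ->]; rewrite /= hom_actE; apply/mem_coboundaries.
exists (@amull K A a \o h)%VF; last by rewrite comp_lfunA.
by move=> b x; rewrite !comp_lfunE hh !lfunE /= mulrA.
Qed.

Definition cohomology i : rmod A^c :=
  @subquot K A^c (hommod (P i)) (cocycles i) (coboundaries i)
    (cocycles_submod (i := i)) (coboundaries_submod (i := i)).

End Cohomology.

Definition Ext (i : nat) M : rmod A^c := cohomology (std_diff M) i.

(* grade M = None stands for inf of the empty set, i.e. +oo.                  *)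

Definition grade M : option nat :=
  if pselect (exists i, \dim {: Ext i M} != 0%N) is left exE
  then Some (ex_minn exE) else None.

End Ext.

Definition grade_lt (g h : option nat) : bool :=
  match g, h with
  | Some i, Some j => (i < j)%N
  | Some _, None => true
  | None, _ => false
  end.

(* D = Hom_K(-, K), from left A-modules to right A-modules:                   *)
(* (xi . a)(x) = xi (a x).                                                    *)

Section Dual.
Context (K : fieldType) (A : falgType K) (M : rmod A^c).

Definition dual_actf (a : A) (xi : 'Hom(M, K^o)) : 'Hom(M, K^o) :=
  (xi \o ract M a)%VF.

Fact dual_actf_linear a : linear (dual_actf a).
Proof. by move=> k f g; rewrite /dual_actf comp_lfunDl -comp_lfunZl. Qed.

HB.instance Definition _ a :=
  GRing.isLinear.Build K _ _ _ (dual_actf a) (dual_actf_linear a).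

Definition dual_act (a : A) : 'End('Hom(M, K^o)) := linfun (dual_actf a).

Lemma dual_actE a xi : dual_act a xi = (xi \o ract M a)%VF.
Proof. by rewrite lfunE. Qed.

Fact dual_act_lin : linear dual_act.
Proof.
move=> k a b; apply/lfunP=> xi; rewrite add_lfunE scale_lfunE !dual_actE.
by rewrite (@ract_lin K A^c) comp_lfunDr -comp_lfunZr.
Qed.

Fact dual_act1 : dual_act 1 = \1%VF.
Proof.
by apply/lfunP=> xi; rewrite dual_actE (@ract1 K A^c) comp_lfun1r id_lfunE.
Qed.

Fact dual_actM a b : dual_act (a * b) = (dual_act b \o dual_act a)%VF.
Proof.
apply/lfunP=> xi; rewrite comp_lfunE !dual_actE -comp_lfunA.
by rewrite -(@ractM K A^c).
Qed.

Definition dual : rmod A := RMod dual_act_lin dual_act1 dual_actM.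

End Dual.

Record quiver (n : nat) := Quiver {
  arrow : finType;
  src : arrow -> 'I_n;
  tgt : arrow -> 'I_n }.

Section QuiverAlgebra.
Context (n : nat) (Q : quiver n).

Fixpoint is_path (i : 'I_n) (p : seq (arrow Q)) : bool :=
  if p is a :: q then (src a == i) && is_path (tgt a) q else true.

(* A path is given by its source and its list of arrows, composed from left   *)
(* to right; (i, [::]) is the trivial path at i.                              *)
Definition qpath := {w : 'I_n * seq (arrow Q) | is_path w.1 w.2}.

Definition qlength (w : qpath) : nat := size (val w).2.

Context (K : fieldType).

(* The vector space underlying the path algebra K Q.                          *)
Definition path_space := {fsfun qpath -> K with 0}.

Context (A : falgType K).

Definition path_val (e : 'I_n -> A) (x : arrow Q -> A) (w : qpath) : A :=
  e (val w).1 * \prod_(a <- (val w).2) x a.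

Definition path_eval (e : 'I_n -> A) (x : arrow Q -> A) (f : path_space) : A :=
  \sum_(w <- finsupp f) f w *: path_val e x w.

(* A = K Q / I with I admissible: the vertices and arrows of Q are sent to    *)
(* elements of A satisfying the relations of K Q, so that path_eval is a      *)
(* morphism of algebras K Q -> A; it is onto and its kernel I satisfies       *)
(* J^m <= I <= J^2 for some m >= 2, where J^m is spanned by the paths of      *)
(* length at least m.                                                         *)
Record quiver_algebra := QuiverAlgebra {
  idem : 'I_n -> A;
  arr : arrow Q -> A;
  idem_orth : forall i j, idem i * idem j = if i == j then idem i else 0;
  idem_sum : \sum_i idem i = 1;
  idem_src : forall a, idem (src a) * arr a = arr a;
  idem_tgt : forall a, arr a * idem (tgt a) = arr a;
  path_eval_onto : forall x, exists f, path_eval idem arr f = x;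
  path_eval_ker_ge : exists2 m, (2 <= m)%N &
    forall f : path_space, (forall w, w \in finsupp f -> (m <= qlength w)%N) ->
      path_eval idem arr f = 0;
  path_eval_ker_le : forall f : path_space, path_eval idem arr f = 0 ->
    forall w, w \in finsupp f -> (2 <= qlength w)%N }.

End QuiverAlgebra.

Section Simples.
Context (K : fieldType) (A : falgType K).

Fact limg_amull_submod (e : A) : @is_submod K A (regmod A) (limg (amull e)).
Proof.
move=> a _ /memv_imgP [x _ ->]; apply/memv_imgP; exists (x * a).
  exact: memvf.
by rewrite !lfunE /= mulrA.
Qed.

Definition idealmod (e : A) : rmod A := submod (@limg_amull_submod e).

Context (n : nat) (Q : quiver n) (qA : quiver_algebra Q A).

Definition simple_at (i : 'I_n) : rmod A := top (idealmod (idem qA i)).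

Definition admissible_order : Prop :=
  forall i j : 'I_n,
    grade_lt (grade (simple_at i)) (grade (simple_at j)) -> (j < i)%N.

Definition grade_perm (s : 'S_n) : Prop :=
  forall i : 'I_n, exists g : nat,
    grade (simple_at i) = Some g /\
    rmod_iso (top (dual (Ext g (simple_at i)))) (simple_at (s i)).

Definition cartan_mx : 'M[int]_n :=
  \matrix_(i, j)
    (\dim (limg (amull (idem qA j) \o amulr (idem qA i))))%:Z.

Definition coxeter_mx : 'M[int]_n := - (cartan_mx^T *m invmx cartan_mx).

End Simples.

Section Bruhat.
Context (R : comUnitRingType) (n : nat).
Implicit Types M U P : 'M[R]_n.

Definition upper_triangular U : Prop :=
  forall i j : 'I_n, (j < i)%N -> U i j = 0.

Definition bruhat_decomposition M U1 P U2 : Prop :=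
  [/\ M \in unitmx, M = U1 *m P *m U2, is_perm_mx P,
      upper_triangular U1 & upper_triangular U2].

(* s i is the row of the non-zero entry of P in column i; perm_mx of the      *)
(* library uses the transposed convention.                                    *)
Definition mx_of_perm (s : 'S_n) : 'M[R]_n := (perm_mx s)^T.

End Bruhat.

(* Main.v *)
(** Write [P(t) = e_t A] and let [I^k(t)] be the terms of the minimal injective
    coresolution of [P(t)], of length [d_t]; the Auslander condition gives
    [pdim I^k(t) <= k].  Hence [Ext^(k+1)(I^k(t), -) = 0], so that every map
    [I^k(u) -> I^k(t)] with [k = d_t] is induced by some [P(u) -> P(t)].  As
    [e_t A e_t] is [K e_t] plus nilpotents, the endomorphisms of the socle of the
    last term are scalars plus nilpotents, so this socle is a simple [S(psi t)];
    as [e_u A e_t] is in the radical for [t <> u], [psi] is injective.  A simple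
    [S(psi t)] in the socle of some [I^k(u)] makes the last term of [P(t)] a
    summand of [I^k(u)], whence [d_t <= k]; thus [grade S(psi t) = d_t], and the
    same lifting of maps shows that [Ext^(d_t)(S(psi t), A)] has socle the left
    simple at [t].  So the grade bijection is [s = psi^-1].  Finally, counting
    composition factors through injectives gives
    [C(t, j) = - sum_k (-1)^k dim Hom(S(j), I^k(t))], and for [t = s i], [j <= i] and
    an admissible ordering only [k = d_t], [j = i] contributes. *)

From HB Require Import structures.
From mathcomp Require Import all_boot all_order all_fingroup all_algebra all_field.
From mathcomp Require Import finmap boolp.
From mathcomp Require Import reals.
From mathcomp Require Import zify ring.
Require Import Defs.

Set Implicit Arguments.
Unset Strict Implicit.
Unset Printing Implicit Defensive.

Import GRing.Theory.
Local Open Scope ring_scope.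

(** * Maps, submodules and injective envelopes *)

(** The Auslander condition is given on one coresolution of [A], and [Ext] is computed from free
    resolutions, whereas the argument lives on separate coresolutions of the [e_t A]. So the bounds
    are carried over by splitting off summands, and Ext classes are matched with maps from a simple
    module to a cosyzygy. Lifts of a map to cosyzygies depend on choices, but any two agree on
    socles. Lifting is therefore kept as a relation, and conclusions are read off on socle vectors:
    a nilpotency statement between projectives becomes an equation between eigenvalues there. The
    grade bijection is not assumed to be well defined or bijective: it comes out as the inverse of
    an injective self-map of the finite vertex set. The Cartan matrix enters through [dim E e_t =
    sum_j dim (e_t A e_j) dim Hom(S(j), E)] for injective [E], which turns an exact sequence of
    injectives into a linear system over the integers. *)

Section Maps.
Context (K : fieldType) (A : falgType K).
Implicit Types M N E X Y Z : rmod A.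

Lemma sub_lfunE (V W : vectType K) (f g : 'Hom(V, W)) x :
  (f - g) x = f x - g x.
Proof. by rewrite add_lfunE opp_lfunE. Qed.

Lemma rhom_comp M N X (f : 'Hom(M, N)) (g : 'Hom(N, X)) :
  rhom f -> rhom g -> @rhom K A M X (g \o f)%VF.
Proof. by move=> hf hg a x; rewrite !comp_lfunE hf hg. Qed.

Lemma rhom0 M N : @rhom K A M N 0.
Proof. by move=> a x; rewrite !zero_lfunE linear0. Qed.

Lemma rhom_id M : @rhom K A M M \1%VF.
Proof. by move=> a x; rewrite !id_lfunE. Qed.

Lemma rhomD M N (f g : 'Hom(M, N)) : rhom f -> rhom g -> @rhom K A M N (f + g).
Proof. by move=> hf hg a x; rewrite !add_lfunE hf hg linearD. Qed.

Lemma rhomZ M N k (f : 'Hom(M, N)) : rhom f -> @rhom K A M N (k *: f).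
Proof. by move=> hf a x; rewrite !scale_lfunE hf linearZ. Qed.

Lemma rhomB M N (f g : 'Hom(M, N)) : rhom f -> rhom g -> @rhom K A M N (f - g).
Proof. by move=> hf hg; rewrite -scaleN1r; apply/rhomD/rhomZ. Qed.

Lemma limg_submod M N (f : 'Hom(M, N)) : rhom f -> is_submod (limg f).
Proof.
move=> hf a _ /memv_imgP [x _ ->]; rewrite -hf; exact: memv_img (memvf _).
Qed.

Lemma ract0 M (x : M) : ract M 0 x = 0.
Proof.
have -> : ract M 0 = 0 by have := ract_lin M (-1) 1 1; rewrite !scaleN1r !addNr.
exact: zero_lfunE.
Qed.

Lemma ractD M a b (x : M) : ract M (a + b) x = ract M a x + ract M b x.
Proof. by have := ract_lin M 1 a b; rewrite !scale1r => ->; rewrite add_lfunE. Qed.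

Lemma ractZ M k a (x : M) : ract M (k *: a) x = k *: ract M a x.
Proof.
have := ract_lin M k a 0; rewrite !addr0 => ->.
by rewrite add_lfunE ract0 addr0 scale_lfunE.
Qed.

Lemma ractB M a b (x : M) : ract M (a - b) x = ract M a x - ract M b x.
Proof. by rewrite -[- b]scaleN1r ractD ractZ scaleN1r. Qed.

Lemma ract_sum M (I : finType) (F : I -> A) (x : M) :
  ract M (\sum_i F i) x = \sum_i ract M (F i) x.
Proof.
by apply: (big_morph (fun a => ract M a x)) => [a b|]; rewrite ?ractD ?ract0.
Qed.

Lemma ractA M a b (x : M) : ract M b (ract M a x) = ract M (a * b) x.
Proof. by rewrite ractM comp_lfunE. Qed.

Lemma ract1E M (x : M) : ract M 1 x = x.
Proof. by rewrite ract1 id_lfunE. Qed.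

Definition incl M (U : {vspace M}) (hU : is_submod U) : 'Hom(submod hU, M) :=
  linfun (@vsval K M U).

Lemma inclE M (U : {vspace M}) (hU : is_submod U) x : incl hU x = vsval x.
Proof. by rewrite /incl lfunE. Qed.

Lemma incl_rhom M (U : {vspace M}) (hU : is_submod U) : rhom (incl hU).
Proof. by move=> a x; rewrite !inclE (sub_actE hU). Qed.

Lemma lker_incl M (U : {vspace M}) (hU : is_submod U) : lker (incl hU) = 0%VS.
Proof.
apply/eqP/lker0P => x y; rewrite !inclE; exact: subvs_inj.
Qed.

Lemma limg_incl M (U : {vspace M}) (hU : is_submod U) : limg (incl hU) = U.
Proof.
apply/vspaceP=> x; apply/memv_imgP/idP.
  by case=> y _ ->; rewrite inclE subvsP.
by move=> Ux; exists (vsproj U x); rewrite ?memvf // inclE vsprojK.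
Qed.

Lemma quot_proj_rhom M (U : {vspace M}) (hU : is_submod U) :
  @rhom K A M (quotmod hU) (quot_proj U).
Proof. by move=> a x; rewrite /= (quot_actE hU). Qed.

Lemma limg_quot_proj M (U : {vspace M}) : limg (quot_proj U) = fullv.
Proof.
apply/vspaceP=> y; rewrite memvf -[y]quot_projK; exact: memv_img (memvf _).
Qed.

Lemma lker_quot_proj M (U : {vspace M}) : lker (quot_proj U) = U.
Proof. by apply/vspaceP=> x; rewrite memv_ker quot_proj0. Qed.

Lemma limg_fullP (V W : vectType K) (f : 'Hom(V, W)) (y : W) :
  limg f = fullv -> exists x, f x = y.
Proof.
move=> f_onto; have : y \in limg f by rewrite f_onto memvf.
by case/memv_imgP=> x _ ->; exists x.
Qed.

Lemma lker0_eq (V W : vectType K) (f : 'Hom(V, W)) x :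
  lker f = 0%VS -> f x = 0 -> x = 0.
Proof. by move=> f0 /eqP; rewrite -memv_ker f0 memv0 => /eqP. Qed.

Lemma lker0_cond (V W : vectType K) (f : 'Hom(V, W)) :
  (forall x, f x = 0 -> x = 0) -> lker f = 0%VS.
Proof.
move=> f0; apply/eqP; rewrite -subv0; apply/subvP=> x.
by rewrite memv_ker memv0 => /eqP /f0 ->.
Qed.

Lemma factor_mono M N E (i : 'Hom(N, E)) (f : 'Hom(M, E)) :
  rhom i -> rhom f -> lker i = 0%VS -> (limg f <= limg i)%VS ->
  exists2 g : 'Hom(M, N), rhom g & (i \o g)%VF = f.
Proof.
move=> hi hf i0 fi; pose g := (i^-1 \o f)%VF.
have ig x : i (g x) = f x.
  by rewrite comp_lfunE limg_lfunVK //; apply: (subvP fi); apply: memv_img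
    (memvf _).
exists g; last by apply/lfunP=> x; rewrite comp_lfunE ig.
move=> a x; apply/eqP; rewrite -subr_eq0; apply/eqP/(lker0_eq i0).
by rewrite linearB /= ig hf hi ig subrr.
Qed.

Lemma factor_epi E Q Y (p : 'Hom(rcar E, rcar Q)) (f : 'Hom(rcar E, rcar Y)) :
  @rhom K A E Q p -> @rhom K A E Y f -> limg p = fullv -> (lker p <= lker f)%VS ->
  exists2 g : 'Hom(rcar Q, rcar Y), @rhom K A Q Y g & (g \o p)%VF = f.
Proof.
move=> hp hf p1 pf; pose g := (f \o p^-1)%VF.
have gp x : g (p x) = f x.
  rewrite comp_lfunE; apply/eqP; rewrite -subr_eq0 -linearB -memv_ker.
  apply: (subvP pf); rewrite memv_ker linearB /= subr_eq0.
  by rewrite limg_lfunVK ?p1 ?memvf.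
exists g; last by apply/lfunP=> x; rewrite comp_lfunE gp.
move=> a y; case: (limg_fullP y p1) => x <-.
by rewrite -hp !gp hf.
Qed.

Lemma corestrict M N (f : 'Hom(M, N)) (U : {vspace N}) (hU : is_submod U) :
  rhom f -> (limg f <= U)%VS ->
  exists2 g : 'Hom(M, submod hU), rhom g & forall x, vsval (g x) = f x.
Proof.
move=> hf fU; case: (@factor_mono M (submod hU) N (incl hU) f).
- exact: incl_rhom.
- exact: hf.
- exact: lker_incl.
- by rewrite limg_incl.
by move=> g hg <-; exists g => // x; rewrite comp_lfunE inclE.
Qed.

(** Injectivity extends along monomorphisms only, so [d] is replaced by the inclusion of its image,
    through which [g] factors. *)
Lemma inj_extend E X Y (d : 'Hom(X, Y)) (g : 'Hom(X, E)) :
  injective_mod E -> rhom d -> rhom g -> (lker d <= lker g)%VS ->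
  exists2 h : 'Hom(Y, E), rhom h & (h \o d)%VF = g.
Proof.
move=> injE hd hg dg; pose hU := limg_submod hd.
case: (corestrict hU hd (subvv _)) => d' hd' d'E.
case: (@factor_epi X (submod hU) E d' g) => //.
- apply/vspaceP=> y; rewrite memvf; have /memv_imgP [x _ yx] := subvsP y.
  apply/memv_imgP; exists x; rewrite ?memvf //.
  by apply: subvs_inj; rewrite d'E.
- apply/subvP=> x; rewrite memv_ker => /eqP dx; apply: (subvP dg).
  by rewrite memv_ker -d'E dx linear0.
move=> g' hg' g'E; case: (injE _ _ (incl hU) g').
- exact: incl_rhom.
- exact: lker_incl.
- exact: hg'.
move=> h hh hE; exists h => //; apply/lfunP=> x.
by rewrite -g'E -hE !comp_lfunE inclE d'E.
Qed.

Lemma proj_lift P Y Z (q : 'Hom(rcar Y, rcar Z)) (h : 'Hom(rcar P, rcar Z)) :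
  projective P -> @rhom K A Y Z q -> @rhom K A P Z h -> (limg h <= limg q)%VS ->
  exists2 g : 'Hom(rcar P, rcar Y), @rhom K A P Y g & (q \o g)%VF = h.
Proof.
move=> prP hq hh hqs; pose hU := limg_submod hq.
case: (corestrict hU hq (subvv _)) => q' hq' q'E.
case: (corestrict hU hh hqs) => h' hh' h'E.
case: (prP _ _ q' h') => //.
  apply/vspaceP=> y; rewrite memvf; have /memv_imgP [x _ yx] := subvsP y.
  apply/memv_imgP; exists x; rewrite ?memvf //.
  by apply: subvs_inj; rewrite q'E.
move=> g hg gE; exists g => //; apply/lfunP=> x.
by rewrite comp_lfunE -q'E -h'E -gE comp_lfunE.
Qed.

End Maps.

Arguments incl_rhom {K A M U} hU.
Arguments lker_incl {K A M U} hU.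
Arguments limg_incl {K A M U} hU.

Section Coinduced.
Context (K : fieldType) (A : falgType K) (V : vectType K).

Definition coind_actf (b : A) (f : 'Hom(A, V)) : 'Hom(A, V) := (f \o amull b)%VF.

Fact coind_actf_linear b : linear (coind_actf b).
Proof. by move=> k f g; rewrite /coind_actf comp_lfunDl -comp_lfunZl. Qed.

HB.instance Definition _ b :=
  GRing.isLinear.Build K _ _ _ (coind_actf b) (coind_actf_linear b).

Definition coind_act (b : A) : 'End('Hom(A, V)) := linfun (coind_actf b).

Lemma coind_actE b f a : coind_act b f a = f (b * a).
Proof. by rewrite lfunE /= comp_lfunE lfunE. Qed.

Fact coind_act_lin : linear coind_act.
Proof.
move=> k a b; apply/lfunP=> f; apply/lfunP=> x.
rewrite add_lfunE scale_lfunE add_lfunE scale_lfunE !coind_actE.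
by rewrite mulrDl linearD -scalerAl linearZ.
Qed.

Fact coind_act1 : coind_act 1 = \1%VF.
Proof.
by apply/lfunP=> f; apply/lfunP=> x; rewrite coind_actE mul1r id_lfunE.
Qed.

Fact coind_actM a b : coind_act (a * b) = (coind_act b \o coind_act a)%VF.
Proof.
by apply/lfunP=> f; apply/lfunP=> x; rewrite comp_lfunE !coind_actE mulrA.
Qed.

(** Coinduction from [K] to [A]: evaluation at 1 identifies [Hom_A(N, coind)] with [Hom_K(N, V)]. *)
Definition coind : rmod A := RMod coind_act_lin coind_act1 coind_actM.

Lemma coind_map (N : rmod A) (f : 'Hom(N, V)) :
  exists2 h : 'Hom(N, coind), rhom h &
    forall x a, (h x : 'Hom(A, V)) a = f (ract N a x).
Proof.
have lin1 x : linear (fun a => f (ract N a x)).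
  by move=> k a b; rewrite ractD ractZ linearP.
pose h1L x : {linear A -> V} :=
  HB.pack (fun a => f (ract N a x)) (GRing.isLinear.Build K _ _ _ _ (lin1 x)).
pose h0 (x : N) : 'Hom(A, V) := linfun (h1L x).
have h0E x a : h0 x a = f (ract N a x) by rewrite lfunE.
have lin0 : linear h0.
  move=> k x y; apply/lfunP=> a; rewrite add_lfunE scale_lfunE !h0E.
  by rewrite !linearP.
pose h0L : {linear N -> coind} :=
  HB.pack h0 (GRing.isLinear.Build K _ _ _ h0 lin0).
have hE x : linfun h0L x = h0 x by rewrite lfunE.
exists (linfun h0L : 'Hom(N, coind)) => [b x|x a]; rewrite !hE // .
by apply/lfunP=> a; rewrite coind_actE !h0E ractA.
Qed.

(** By the adjunction, extending along [g] is a problem of linear algebra, solved by the linear left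
    inverse of [g]. *)
Lemma coind_injective : injective_mod coind.
Proof.
move=> M N g f hg g0 hf.
pose ev x := (f x : 'Hom(A, V)) 1.
have ev_lin : linear ev by move=> k x y; rewrite /ev linearP add_lfunE scale_lfunE.
pose evL : {linear M -> V} := HB.pack ev (GRing.isLinear.Build K _ _ _ ev ev_lin).
have [h hh hE] := coind_map (linfun evL \o g^-1)%VF.
exists h => //; apply/lfunP=> x; rewrite comp_lfunE; apply/lfunP=> a.
by rewrite hE -hg comp_lfunE lker0_lfunK ?g0 // lfunE /= /ev hf coind_actE mulr1.
Qed.

End Coinduced.

Section Envelope.
Context (K : fieldType) (A : falgType K).
Implicit Types M N E X Y Z : rmod A.

Lemma enough_injectives N :
  exists E (i : 'Hom(N, E)), [/\ injective_mod E, rhom i & lker i = 0%VS].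
Proof.
have [h hh hE] := coind_map (\1%VF : 'Hom(N, N)).
exists (coind A N), h; split=> //; first exact: coind_injective.
apply: lker0_cond => x hx; have := hE x 1.
by rewrite ract1E id_lfunE => <-; rewrite hx zero_lfunE.
Qed.

Lemma endo_inverse M (f : 'Hom(M, M)) : rhom f -> lker f = 0%VS ->
  exists2 g : 'Hom(M, M), rhom g & (g \o f)%VF = \1%VF /\ (f \o g)%VF = \1%VF.
Proof.
move=> hf f0; have f1 : limg f = fullv.
  by apply/eqP; rewrite eqEdim subvf /= limg_dim_eq // f0 capv0.
have f1' : (limg (\1 : 'End(M)) <= limg f)%VS by rewrite f1 subvf.
have [g hg fg] := factor_mono hf (@rhom_id _ _ M) f0 f1'.
exists g => //; split=> //; apply/lfunP=> x; rewrite comp_lfunE id_lfunE.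
apply/eqP; rewrite -subr_eq0; apply/eqP/(lker0_eq f0); rewrite linearB /=.
by rewrite -[f (g _)]comp_lfunE fg id_lfunE subrr.
Qed.

(** In finite dimension the monomorphism [r \o i] is an automorphism; correcting [r] by its inverse
    makes [Y] a summand of [E]. *)
Lemma injective_retract E Y (i : 'Hom(Y, E)) (r : 'Hom(E, Y)) :
  injective_mod E -> rhom i -> rhom r -> lker (r \o i)%VF = 0%VS ->
  injective_mod Y.
Proof.
move=> injE hi hr ri0 M N g f hg g0 hf.
have [s hs [sri _]] := endo_inverse (rhom_comp hi hr) ri0.
have [h hh hE] := injE _ _ g (i \o f)%VF hg g0 (rhom_comp hf hi).
exists (s \o (r \o h))%VF; first exact: rhom_comp (rhom_comp hh hr) hs.
by rewrite -!comp_lfunA hE comp_lfunA -[(s \o r \o _)%VF]comp_lfunA comp_lfunA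
  comp_lfunA
  -[(s \o r \o i)%VF]comp_lfunA sri comp_lfun1l.
Qed.

(** The kernel of [f] is a submodule meeting the essential image of [i] only in zero. *)
Lemma essential_lker N E Y (i : 'Hom(N, E)) (f : 'Hom(E, Y)) :
  essential (limg i) -> rhom f -> lker (f \o i)%VF = 0%VS -> lker f = 0%VS.
Proof.
move=> ess hf fi0; apply: ess; first exact: lker_submod hf.
apply/eqP; rewrite -subv0; apply/subvP=> x /memv_capP [/memv_imgP [y _ ->]].
rewrite memv_ker => /eqP fiy; rewrite (_ : y = 0) ?linear0 ?mem0v //.
by apply: (lker0_eq fi0); rewrite comp_lfunE.
Qed.

Lemma submod0 M : @is_submod _ _ M 0%VS.
Proof. by move=> a x; rewrite !memv0 => /eqP ->; rewrite linear0. Qed.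

Lemma submod_preim M N (f : 'Hom(M, N)) (W : {vspace N}) :
  rhom f -> is_submod W -> @is_submod _ _ M (f @^-1: W)%VS.
Proof. by move=> hf hW a x; rewrite -!memv_preim hf; apply: hW. Qed.

Lemma max_complement E (U : {vspace E}) :
  exists2 W : {vspace E}, is_submod W /\ (U :&: W)%VS = 0%VS &
    forall W' : {vspace E}, is_submod W' -> (W <= W')%VS ->
      (U :&: W')%VS = 0%VS -> W' = W.
Proof.
pose good d := exists W : {vspace E},
  [/\ is_submod W, (U :&: W)%VS = 0%VS & \dim W = d].
have ex_good : exists d, `[< good d >].
  exists 0%N; apply/asboolP; exists 0%VS; split; rewrite ?capv0 ?dimv0 //.
  exact: submod0.
have good_le d : `[< good d >] -> (d <= dim E)%N.
  by move/asboolP=> [W [_ _ <-]]; rewrite -dimvf dimvS ?subvf.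
case: (ex_maxnP ex_good good_le) => d /asboolP [W [hW UW dW]] max_d.
exists W => // W' hW' WW' UW'; apply/esym/eqP; rewrite eqEdim WW' /= dW.
by apply: max_d; apply/asboolP; exists W'.
Qed.

(** Dividing an injective [E] containing [N] by a maximal submodule [W] with [N :&: W = 0] makes [N]
    essential in [E / W]. The extension [th : E / W -> E] of [i] is then mono, and so is its
    composite with the projection, so [E / W] is a retract of [E]. *)
Lemma injective_envelope N :
  exists E (i : 'Hom(N, E)),
    [/\ injective_mod E, rhom i, lker i = 0%VS & essential (limg i)].
Proof.
have [E [i [injE hi i0]]] := enough_injectives N.
have [W [hW iW] maxW] := max_complement (limg i).
pose F := quotmod hW; pose q : 'Hom(E, F) := quot_proj W.
have hq : rhom q by exact: quot_proj_rhom.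
have hqi : rhom (q \o i)%VF by exact: rhom_comp.
have kq x : (q x == 0) = (x \in W) by exact: quot_proj0.
have qi0 : lker (q \o i)%VF = 0%VS.
  apply: lker0_cond => x /eqP; rewrite comp_lfunE kq => Wx.
  apply: (lker0_eq i0); apply/eqP; rewrite -memv0 -iW memv_cap Wx.
  by rewrite memv_img ?memvf.
have ess : essential (limg (q \o i)).
  move=> Z hZ qiZ; pose W' : {vspace E} := (q @^-1: Z)%VS.
  (* The preimage of a submodule missing [N] contains [W] and still misses [N], so maximality
     applies. *)
  have eqW : W' = W.
    apply: maxW; first exact: submod_preim.
      apply/subvP=> x; rewrite -kq => /eqP qx0; rewrite /W' -memv_preim qx0.
      exact: mem0v.
    apply/eqP; rewrite -subv0; apply/subvP=> x /memv_capP [/memv_imgP [y _ ->]].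
    rewrite -memv_preim => Zqiy; rewrite -iW memv_cap memv_img ?memvf //= -kq.
    rewrite -memv0 -qiZ memv_cap Zqiy andbT -comp_lfunE.
    exact: memv_img (memvf _).
  apply/eqP; rewrite -subv0; apply/subvP=> z Zz.
  have [x qx] : exists x, q x = z by apply: limg_fullP; exact: limg_quot_proj.
  have : x \in W' by rewrite -memv_preim qx.
  by rewrite eqW -kq qx memv0.
have [th hth thE] := injE _ _ _ _ hqi qi0 hi.
have th0 : lker th = 0%VS.
  by apply: (essential_lker ess) => //; rewrite thE.
exists F, (q \o i)%VF; split=> //.
apply: (injective_retract injE hth hq); apply: (essential_lker ess).
  exact: rhom_comp.
by rewrite -comp_lfunA thE; exact: qi0.
Qed.

End Envelope.

(** * Basic algebras and socles *)

(** What is used of a quiver algebra: [J] is a nilpotent two-sided ideal and [A / J] is a product of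
    copies of [K]. The last field says that a power of [J] is zero, without forming powers of
    ideals. *)
Record split_basic (K : fieldType) (A : falgType K) (n : nat)
    (e : 'I_n -> A) (J : {vspace A}) : Prop := SplitBasic {
  sb_orth : forall i j, e i * e j = if i == j then e i else 0;
  sb_sum : \sum_i e i = 1;
  sb_neq0 : forall i, e i != 0;
  sb_mull : forall a b, b \in J -> a * b \in J;
  sb_mulr : forall a b, b \in J -> b * a \in J;
  sb_split : forall a, exists c : 'I_n -> K, a - \sum_i c i *: e i \in J;
  sb_nilp : exists m, forall s : seq A,
    size s = m -> {subset s <= J} -> \prod_(a <- s) a = 0 }.

Section Socle.
Context (K : fieldType) (A : falgType K) (n : nat) (e : 'I_n -> A).
Context (J : {vspace A}) (sb : split_basic e J).
Implicit Types M N E X Y Z : rmod A.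

Lemma sum_e M (x : M) : x = \sum_i ract M (e i) x.
Proof. by rewrite -ract_sum (sb_sum sb) ract1E. Qed.

Lemma e_id i : e i * e i = e i.
Proof. by rewrite (sb_orth sb) eqxx. Qed.

Lemma J_nilpotent a : a \in J -> exists m, a ^+ m = 0.
Proof.
have [m Hm] := sb_nilp sb => Ja; exists m.
rewrite -(Hm (nseq m a)) ?size_nseq //; last first.
  by move=> b; rewrite mem_nseq => /andP [_ /eqP ->].
by rewrite big_nseq; elim: m {Hm} => //= m <-; rewrite exprS.
Qed.

Lemma e_mul_split i a : exists c : K, e i * a * e i - c *: e i \in J.
Proof.
have [c Jc] := sb_split sb a; exists (c i).
have -> : c i *: e i = e i * (\sum_j c j *: e j) * e i.
  rewrite mulr_sumr mulr_suml (bigD1 i) //= big1 ?addr0 => [|j ji].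
    by rewrite -scalerAr -scalerAl !e_id.
  by rewrite -scalerAr (sb_orth sb) eq_sym (negPf ji) scaler0 mul0r.
by rewrite -mulrBl -mulrBr; apply/(sb_mulr sb)/(sb_mull sb).
Qed.

Lemma e_mul_offdiag i j a : i != j -> e i * a * e j \in J.
Proof.
move=> ij; have [c Jc] := sb_split sb a.
have <- : e i * (a - \sum_l c l *: e l) * e j = e i * a * e j.
  rewrite mulrBr mulrBl [X in _ - X](_ : _ = 0) ?subr0 //.
  rewrite mulr_sumr mulr_suml big1 // => l _.
  rewrite -scalerAr -scalerAl !(sb_orth sb); case: eqP => [il|_].
    by rewrite (sb_orth sb) (negPf ij) scaler0.
  by rewrite mul0r scaler0.
exact/(sb_mulr sb)/(sb_mull sb).
Qed.

(** The [S(j)]-isotypic part of the socle of [M], that is, [Hom(S(j), M)]. *)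
Definition socle M (j : 'I_n) : {vspace M} :=
  subspace_of (fun x : M =>
    ract M (e j) x = x /\ forall a, a \in J -> ract M a x = 0).

Lemma socleP M j x : reflect
  (ract M (e j) x = x /\ forall a, a \in J -> ract M a x = 0) (x \in socle M j).
Proof.
apply/equivP; [exact: idP | apply: subspace_ofP].
split=> [|k u v [u1 u2] [v1 v2]].
  by split=> [|a _]; rewrite linear0.
by split=> [|a Ja]; rewrite linearP /= ?u1 ?v1 // u2 // v2 // scaler0 addr0.
Qed.

(** A simple submodule of the nonzero module [(U + V) / U], stated on a representative. It is
    reached by multiplying [v] by elements of [J] as long as the result stays outside [U]; the
    induction is on an [m] with [v J^m] inside [U]. *)
Lemma socle_rel M (U V : {vspace M}) : is_submod U -> is_submod V ->
  ~~ (V <= U)%VS ->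
  exists j, exists2 x, x \in V /\ x \notin U &
    ract M (e j) x = x /\ forall a, a \in J -> ract M a x \in U.
Proof.
move=> hU hV /subvPn [v Vv Uv].
suff [x [Vx Ux] xJ] : exists2 x, x \in V /\ x \notin U &
    forall a, a \in J -> ract M a x \in U.
  have [j Uxj] : exists j, ract M (e j) x \notin U.
    apply/existsP; apply: contraR Ux; rewrite negb_exists => /forallP h.
    by rewrite (sum_e x) memv_suml // => i _; rewrite -[_ \in _]negbK.
  exists j, (ract M (e j) x); first by split=> //; exact: hV.
  split=> [|a Ja]; rewrite ractA ?e_id //; apply: xJ; exact: (sb_mull sb).
have [m Hm] := sb_nilp sb.
have {Hm} : forall s : seq A, size s = m -> {subset s <= J} ->
    ract M (\prod_(a <- s) a) v \in U.
  by move=> s sm sJ; rewrite Hm // ract0 mem0v.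
elim: m v Vv Uv => [|m IH] v Vv Uv Hm.
  by case/negP: Uv; have := Hm [::] erefl; rewrite big_nil ract1E; apply.
case: (pselect (exists2 a, a \in J & ract M a v \notin U)) => [[a Ja Ua]|no].
  apply: (IH (ract M a v)) => //; first exact: hV.
  move=> s sm sJ; rewrite ractA; have := Hm (a :: s); rewrite big_cons; apply.
    by rewrite /= sm.
  by move=> b; rewrite inE => /orP [/eqP -> | /sJ].
exists v => // a Ja; apply: contra_notT no => Ua; by exists a.
Qed.

Lemma socle_neq0 M (V : {vspace M}) : is_submod V -> V <> 0%VS ->
  exists j, exists2 x, x \in socle M j & x \in V /\ x != 0.
Proof.
move=> hV V0; have [||j [x [Vx x0] [xe xJ]]] := @socle_rel M 0%VS V _ hV.
- exact: submod0.
- by apply/negP; rewrite subv0 => /eqP.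
exists j, x; first by apply/socleP; split=> // a /xJ; rewrite memv0 => /eqP.
by rewrite -memv0.
Qed.

(** The scalar is the value at [a] of the character of [S(j)]. That it does not depend on [M] makes
    linear maps between socle lines of different modules [A]-linear. *)
Lemma socle_char j a : exists c, forall M (x : M),
  x \in socle M j -> ract M a x = c *: x.
Proof.
have [c Jc] := sb_split sb a; exists (c j) => M x /socleP [xe xJ].
rewrite -[a](subrK (\sum_i c i *: e i)) ractD xJ // add0r ract_sum.
rewrite (bigD1 j) //= ractZ xe big1 ?addr0 // => i ij.
by rewrite ractZ -xe ractA (sb_orth sb) eq_sym (negPf ij) ract0 scaler0.
Qed.

Lemma socle_line M j x : x \in socle M j -> @is_submod _ _ M <[x]>%VS.
Proof.
move=> xs a _ /vlineP [k ->]; rewrite linearZ /=.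
by have [c cterm] := socle_char j a; rewrite cterm // !memvZ ?memv_line.
Qed.

Lemma essential_socle M (U : {vspace M}) j x :
  essential U -> x \in socle M j -> x \in U.
Proof.
move=> essU xs; case: (eqVneq x 0) => [->|x0]; first exact: mem0v.
apply: contraNT x0 => Ux; have := essU _ (socle_line xs).
suff -> : (U :&: <[x]>)%VS = 0%VS.
  by move/(_ erefl)/eqP; rewrite -subv0 => /subvP /(_ x (memv_line x)); rewrite
    memv0.
apply/eqP; rewrite -subv0; apply/subvP=> y /memv_capP [Uy /vlineP [k yk]].
rewrite yk; case: (eqVneq k 0) => [->|k0]; first by rewrite scale0r mem0v.
case/negP: Ux; rewrite -[x](scalerK k0) -yk; exact: memvZ.
Qed.

Lemma socle_img M N (f : 'Hom(M, N)) j x :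
  rhom f -> x \in socle M j -> f x \in socle N j.
Proof.
move=> hf /socleP [xe xJ]; apply/socleP.
by split=> [|a Ja]; rewrite -hf ?xe // xJ // linear0.
Qed.

Lemma lker0_socle M N (f : 'Hom(M, N)) : rhom f ->
  (forall j x, x \in socle M j -> f x = 0 -> x = 0) -> lker f = 0%VS.
Proof.
move=> hf fx; apply/eqP; apply: contraT => /eqP k0.
have [j [x xs [xk x0]]] := socle_neq0 (lker_submod hf) k0.
by case/eqP: x0; apply: (fx _ _ xs); apply/eqP; rewrite -memv_ker.
Qed.

End Socle.

(** * Quiver algebras are split basic *)

Section Quiver.
Context (K : fieldType) (A : falgType K) (n : nat) (Q : quiver n).
Context (qA : quiver_algebra Q A).

Definition path_delta (w : qpath Q) : path_space Q K :=
  [fsfun v in [fset w]%fset => 1 : K].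

Lemma finsupp_path_delta w : finsupp (path_delta w) = [fset w]%fset.
Proof.
apply/fsetP=> v; rewrite mem_finsupp fsfunE !inE.
by case: (v == w); rewrite ?oner_eq0 ?eqxx.
Qed.

Lemma path_eval_delta e (x : arrow Q -> A) w :
  path_eval e x (path_delta w) = path_val e x w.
Proof.
rewrite /path_eval finsupp_path_delta big_seq_fset1 fsfunE !inE eqxx.
by rewrite scale1r.
Qed.

Local Notation e := (idem qA).
Local Notation x := (arr qA).

Lemma idem_arr i a : e i * x a = if src a == i then x a else 0.
Proof.
by rewrite -(idem_src qA a) mulrA idem_orth eq_sym; case: eqP => [->|]; rewrite
  ?mul0r.
Qed.

(** Otherwise the trivial path, of length 0, would lie in the admissible ideal, whose elements only
    involve paths of length at least 2. *)
Lemma idem_neq0 i : e i != 0.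
Proof.
apply/eqP => e0; pose w : qpath Q := exist (fun w => is_path w.1 w.2) (i, [::]) isT.
have /(path_eval_ker_le (q := qA))/(_ w) : path_eval e x (path_delta w) = 0.
  by rewrite path_eval_delta /path_val /= e0 mul0r.
by rewrite finsupp_path_delta !inE eqxx => /(_ isT).
Qed.

Lemma idem_nonpath i p : ~~ is_path i p -> e i * \prod_(a <- p) x a = 0.
Proof.
elim: p i => [|a p IH] i //=; rewrite big_cons mulrA idem_arr.
case: eqP => [_ /= /IH h|_ _]; last by rewrite mul0r.
by rewrite -(idem_tgt qA a) -mulrA h mulr0.
Qed.

(** Admissibility bounds the nonzero paths; a sequence of arrows that is not a path has product zero
    anyway. *)
Lemma arr_prod0 : exists m, forall p : seq (arrow Q),
  size p = m -> \prod_(a <- p) x a = 0.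
Proof.
have [m m2 km] := path_eval_ker_ge qA; exists m => p pm.
case: p pm => [m0|a p pm]; first by rewrite -m0 in m2.
have -> : \prod_(b <- a :: p) x b = e (src a) * \prod_(b <- a :: p) x b.
  by rewrite big_cons mulrA idem_src.
case: (boolP (is_path (src a) (a :: p))) => [pth|/idem_nonpath -> //].
pose w : qpath Q := exist (fun w => is_path w.1 w.2) (src a, a :: p) pth.
have := km (path_delta w); rewrite path_eval_delta; apply=> v.
by rewrite finsupp_path_delta !inE => /eqP ->; rewrite /qlength /= -pm.
Qed.

(** Only a right ideal by construction; it is two-sided because [A] is spanned by the idempotents
    and the elements starting with an arrow. *)
Definition arrow_ideal : {vspace A} := (\sum_a limg (amull (x a)))%VS.
Local Notation J := arrow_ideal.

Lemma arrow_idealP b : reflect (exists z, b = \sum_a x a * z a) (b \in J).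
Proof.
apply: (iffP memv_sumP) => [[u uE ->]|[z ->]].
  have z_ex a : exists z, u a = x a * z.
    by have /memv_imgP [z _ ->] := uE a isT; exists z; rewrite lfunE.
  exists (fun a => projT1 (cid (z_ex a))); apply: eq_bigr => a _.
  by case: (cid (z_ex a)).
exists (fun a => x a * z a) => // a _; apply/memv_imgP.
by exists (z a); rewrite ?memvf // lfunE.
Qed.

Lemma arr_mem a z : x a * z \in J.
Proof.
rewrite /arrow_ideal (bigD1 a) //=; apply: (subvP (addvSl _ _)).
by apply/memv_imgP; exists z; rewrite ?memvf // lfunE.
Qed.

Lemma path_val_split w : (exists i, path_val e x w = e i) \/
  exists a z, path_val e x w = x a * z.
Proof.
case: w => [[i [|a p]] /= pth]; rewrite /path_val /=; [left | right].
  by exists i; rewrite big_nil mulr1.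
exists a, (\prod_(b <- p) x b); rewrite big_cons mulrA idem_arr.
by case/andP: pth => ->.
Qed.

Lemma algebra_ind (P : A -> Prop) : P 0 -> (forall k a b, P a -> P b -> P (k *:
  a + b)) ->
  (forall i, P (e i)) -> (forall a z, P (x a * z)) -> forall a, P a.
Proof.
move=> P0 Plin Pe Px a; have [f <-] := path_eval_onto qA a.
rewrite /path_eval; apply: (big_ind P) => [//|b c Pb Pc|w _].
  by rewrite -[b]scale1r; apply: Plin.
rewrite -[_ *: _]addr0; apply: Plin => //.
by case: (path_val_split w) => [[i ->]|[b [z ->]]].
Qed.

Lemma arrow_ideal_mulr a b : b \in J -> b * a \in J.
Proof.
case/arrow_idealP=> z ->; rewrite mulr_suml memv_suml // => c _.
by rewrite -mulrA arr_mem.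
Qed.

Lemma arrow_ideal_mull a b : b \in J -> a * b \in J.
Proof.
case/arrow_idealP=> z ->; rewrite mulr_sumr memv_suml // => c _.
rewrite mulrA; apply: arrow_ideal_mulr; move: a; apply: algebra_ind.
- by rewrite mul0r mem0v.
- by move=> k y z1 Jy Jz; rewrite mulrDl -scalerAl memvD ?memvZ.
- move=> i; rewrite idem_arr; case: eqP => _; last exact: mem0v.
  by rewrite -[x c]mulr1 arr_mem.
- by move=> d t; rewrite -mulrA arr_mem.
Qed.

Lemma quiver_split_basic : split_basic (idem qA) J.
Proof.
split.
- exact: idem_orth.
- exact: idem_sum.
- exact: idem_neq0.
- exact: arrow_ideal_mull.
- exact: arrow_ideal_mulr.
- apply: algebra_ind.
  + exists (fun=> 0); rewrite big1 ?subrr ?mem0v // => i _; exact: scale0r.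
  + move=> k a b [c Jc] [d Jd]; exists (fun i => k * c i + d i).
    rewrite (eq_bigr (fun i => k *: (c i *: e i) + d i *: e i)) => [|i _].
      rewrite big_split -scaler_sumr /= opprD addrACA -scalerBr.
      by rewrite memvD ?memvZ.
    by rewrite scalerDl scalerA.
  + move=> i; exists (fun j => (j == i)%:R).
    rewrite (bigD1 i) //= eqxx scale1r big1 ?addr0 ?subrr ?mem0v // => j /negPf ->.
    exact: scale0r.
  + move=> a z; exists (fun=> 0); rewrite big1 ?subr0 ?arr_mem // => i _.
    exact: scale0r.
- have [m Hm] := arr_prod0; exists m => s sm sJ.
  (* Factors from [J] are turned into arrows one at a time: [z * b] is a sum of terms [x a * t a],
     and [a] is appended to [p]. When [s] is used up, [p] consists of [m] arrows. *)
  suff key : forall (p : seq (arrow Q)) z, (size p + size s)%N = m ->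
      \prod_(a <- p) x a * z * \prod_(a <- s) a = 0.
    by have := key [::] 1; rewrite big_nil !mul1r; apply.
  elim: s sJ {sm} => [|b s IH] sJ p z.
    by rewrite addn0 => /Hm ->; rewrite !mul0r.
  rewrite /= addnS -addSn => psm; rewrite big_cons mulrA -[X in X * _]mulrA.
  have Jzb : z * b \in J by apply/arrow_ideal_mull/sJ; rewrite inE eqxx.
  case/arrow_idealP: Jzb => t ->; rewrite mulr_sumr mulr_suml big1 // => a _.
  have := IH _ (rcons p a) (t a); rewrite size_rcons psm.
  rewrite -cats1 big_cat big_seq1 /= !mulrA; apply=> // c sc.
  by apply: sJ; rewrite inE sc orbT.
Qed.

End Quiver.

(** * Simple modules and tops *)

Section Simple.
Context (K : fieldType) (A : falgType K) (n : nat) (e : 'I_n -> A).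
Context (J : {vspace A}) (sb : split_basic e J).
Implicit Types M N S W : rmod A.

(** [S] is a copy of the one-dimensional module [S(j)], with basis [x]. *)
Definition simple_gen j S (x : S) : Prop :=
  [/\ x \in socle e J S j, x != 0 & forall y : S, exists c, y = c *: x].

Lemma simple_hom j S (x : S) N (y : N) : simple_gen j x -> y \in socle e J N j ->
  exists2 h : 'Hom(S, N), rhom h & h x = y.
Proof.
case=> xs x0 xgen ys; pose h0 (v : S) := coord [tuple x] ord0 v *: y.
have fx : free [tuple x] by rewrite /= seq1_free.
have h0_lin : linear h0.
  by move=> k u v; rewrite /h0 linearP scalerDl scalerA.
pose hL : {linear S -> N} := HB.pack h0 (GRing.isLinear.Build K _ _ _ h0 h0_lin).
have h0Z c : h0 (c *: x) = c *: y.
  by rewrite /h0 linearZ /= (coord_free ord0 ord0 fx) /= mulr1.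
exists (linfun hL : 'Hom(S, N)) => [a v|]; last first.
  by rewrite lfunE /= -[x]scale1r h0Z scale1r.
rewrite !lfunE /=; have [c ->] := xgen v; have [d dE] := socle_char sb j a.
by rewrite linearZ /= dE // scalerA !h0Z linearZ /= dE // scalerA.
Qed.

Lemma simple_iso j S N (x : S) (y : N) :
  simple_gen j x -> simple_gen j y -> rmod_iso S N.
Proof.
move=> xS yT; case: (xS) (yT) => [xs x0 xgen] [ys y0 ygen].
have [f hf fx] := simple_hom xS ys.
exists f; split=> //.
  apply: lker0_cond => v; have [c ->] := xgen v; rewrite linearZ /= fx.
  by move/eqP; rewrite scaler_eq0 (negPf y0) orbF => /eqP ->; rewrite scale0r.
apply/vspaceP=> v; rewrite memvf; have [c ->] := ygen v.
by rewrite -fx -linearZ; apply: memv_img (memvf _).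
Qed.

(** The map between the socle lines is extended from the line of [x] to [M] by injectivity. This is
    the source of all maps between cosyzygies with a prescribed effect on a socle vector. *)
Lemma socle_extend j M (x : M) W (y : W) : injective_mod W ->
  x \in socle e J M j -> x != 0 -> y \in socle e J W j ->
  exists2 h : 'Hom(M, W), rhom h & h x = y.
Proof.
move=> injW xs x0 ys; pose hL := socle_line sb xs.
have xL : x \in <[x]>%VS by exact: memv_line.
pose x' : submod hL := vsproj _ x.
have x'E : vsval x' = x by rewrite vsprojK.
have genx' : simple_gen j x'.
  split=> [||v].
  - apply/socleP; have /socleP [xe xJ] := xs.
    by split=> [|a Ja]; apply: subvs_inj; rewrite (sub_actE hL) x'E ?xe ?xJ.
  - by apply: contraNneq x0 => x'0; rewrite -x'E x'0.
  - by have /vlineP [c vc] := subvsP v; exists c; apply: subvs_inj; rewrite vc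
    linearZ /= x'E.
have [f hf fx] := simple_hom genx' ys.
have [h hh hE] := injW _ _ _ _ (incl_rhom hL) (lker_incl hL) hf.
by exists h => //; rewrite -fx -hE comp_lfunE inclE x'E.
Qed.

Section Cyclic.
Context (M : rmod A) (x : M) (t : 'I_n).
Hypotheses (xe : ract M (e t) x = x) (x0 : x != 0).
Hypothesis (xgen : forall y : M, exists a, y = ract M a x).

Fact orbit_linear : linear (fun a => ract M a x).
Proof. by move=> k a b; rewrite ractD ractZ. Qed.
Let orbitL : {linear A -> M} :=
  HB.pack (fun a => ract M a x) (GRing.isLinear.Build K _ _ _ _ orbit_linear).
Let W0 : {vspace M} := (linfun orbitL @: J)%VS.

Let W0P y : reflect (exists2 a, a \in J & y = ract M a x) (y \in W0).
Proof.
apply: (iffP memv_imgP) => [[a Ja ->]|[a Ja ->]]; exists a => //; by rewrite lfunE.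
Qed.

Let W0_submod : is_submod W0.
Proof.
move=> a y /W0P [b Jb ->]; apply/W0P; exists (b * a); last by rewrite ractA.
exact: (sb_mulr sb).
Qed.

Let split_gen y : exists c, exists2 w, w \in W0 & y = c *: x + w.
Proof.
have [a ->] := xgen y; have [c Jc] := sb_split sb a.
exists (c t), (ract M (e t * (a - \sum_i c i *: e i)) x).
  by apply/W0P; exists (e t * (a - \sum_i c i *: e i)) => //; apply: (sb_mull sb).
have eS : e t * (\sum_i c i *: e i) = c t *: e t.
  rewrite mulr_sumr (bigD1 t) //= big1 ?addr0 => [|i it].
    by rewrite -scalerAr (e_id sb).
  by rewrite -scalerAr (sb_orth sb) eq_sym (negPf it) scaler0.
by rewrite mulrBr eS ractB ractZ xe -[ract M (e t * a) x]ractA xe addrC subrK.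
Qed.

Let x_notin : x \notin W0.
Proof.
apply/negP=> /W0P [a Ja xa]; have [m am] := J_nilpotent sb Ja.
case/eqP: x0; rewrite -(ract0 x) -am.
by elim: m {am} => [|m IH]; rewrite ?ract1E // exprS -ractA -xa.
Qed.

Let gen_full (W : {vspace M}) : is_submod W -> x \in W -> W = fullv.
Proof.
move=> hW Wx; apply/vspaceP=> y; rewrite memvf; have [a ->] := xgen y.
exact: hW.
Qed.

(** An element of [W] outside [x J] is, up to a nonzero scalar, [x (1 + b)] with [b] in [J]; as [b]
    is nilpotent, [1 + b] is invertible, so [W] contains the generator [x]. *)
Let max_sub (W : {vspace M}) : is_submod W -> W <> fullv -> (W <= W0)%VS.
Proof.
move=> hW Wn; apply/subvP=> y Wy; apply: contra_notT Wn => W0y.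
apply: gen_full => //; have [c [w W0w yE]] := split_gen y.
have c0 : c != 0 by apply: contraNneq W0y => c0; rewrite yE c0 scale0r add0r.
have /W0P [a Ja wa] := W0w; pose b := c^-1 *: a.
have Jb : - b \in J by rewrite memvN memvZ.
have Wb : ract M (1 + b) x \in W.
  by rewrite ractD ract1E /b ractZ -wa -[x](scalerK c0) -scalerDr -yE memvZ.
have [m bm] := J_nilpotent sb Jb.
(* Partial sums of the geometric series for the inverse of [1 + b], applied to [x (1 + b)]. *)
suff /(_ m) : forall k, x - ract M ((- b) ^+ k) x \in W by rewrite bm ract0 subr0.
elim=> [|k IH]; first by rewrite expr0 ract1E subrr mem0v.
rewrite -[x](subrK (ract M ((- b) ^+ k) x)) -addrA memvD // subrK.
rewrite -ractB (_ : _ - _ = (1 + b) * (- b) ^+ k) -?ractA; first exact: hW.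
by rewrite exprS mulrDl mul1r mulNr opprK.
Qed.

Let W0_max : max_submod W0.
Proof.
split=> // [W0f | W hW W0W]; first by move: x_notin; rewrite W0f memvf.
case: (pselect (W = fullv)) => [|/(max_sub hW) WW0]; [by right | left].
by apply/eqP; rewrite eqEsubv WW0.
Qed.

Let rad_cyclic : rad M = W0.
Proof.
apply/eqP; rewrite eqEsubv; apply/andP; split; apply/subvP=> y.
  by move/mem_rad=> h; apply: (h _ W0_max).
move=> W0y; apply/mem_rad=> W [hW Wn Wmax].
case: (Wmax _ W0_submod (max_sub hW Wn)) => [<- //|W0f].
by move: x_notin; rewrite W0f memvf.
Qed.

(** The submodule [x J] is the unique maximal one, hence the radical. This serves both [e_t A] and
    the dual of an Ext module. *)
Lemma cyclic_top : exists y : top M, simple_gen t y.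
Proof.
pose q : 'Hom(M, top M) := quot_proj (rad M).
have hq : rhom q by exact: quot_proj_rhom.
have q0 y : (q y == 0) = (y \in W0) by rewrite -rad_cyclic; apply: quot_proj0.
exists (q x); split.
- apply/socleP; split=> [|a Ja]; rewrite -hq ?xe //.
  by apply/eqP; rewrite q0; apply/W0P; exists a.
- by rewrite q0.
- move=> z; have [y <-] : exists y, q y = z by apply: limg_fullP (limg_quot_proj _).
  have [c [w W0w ->]] := split_gen y; exists c.
  have /eqP qw : q w == 0 by rewrite q0.
  by rewrite linearP /= qw addr0.
Qed.

End Cyclic.

Definition ideal_val (u : A) (a : idealmod u) : A := @vsval K A _ a.

Lemma ideal_valP (u : A) (a : idealmod u) : exists b, ideal_val a = u * b.
Proof. by have /memv_imgP [b _ ab] := subvsP a; exists b; rewrite /ideal_val ab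
  lfunE. Qed.

Lemma ideal_val_inj (u : A) : injective (@ideal_val u).
Proof. exact: subvs_inj. Qed.

Definition ideal_gen t : idealmod (e t) := vsproj _ (e t).

Lemma ideal_genE t : ideal_val (ideal_gen t) = e t.
Proof.
rewrite /ideal_val vsprojK //; apply/memv_imgP; exists (e t); first exact: memvf.
by rewrite lfunE /= (e_id sb).
Qed.

Lemma ideal_actE u a (b : idealmod u) :
  ideal_val (ract (idealmod u) a b) = ideal_val b * a.
Proof. by rewrite /ideal_val (sub_actE (@limg_amull_submod _ _ u)) lfunE. Qed.

Lemma ideal_genP t (y : idealmod (e t)) :
  y = ract (idealmod (e t)) (ideal_val y) (ideal_gen t).
Proof.
apply: ideal_val_inj; rewrite ideal_actE ideal_genE.
by have [b ->] := ideal_valP y; rewrite mulrA (e_id sb).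
Qed.

Lemma ideal_gen_e t : ract (idealmod (e t)) (e t) (ideal_gen t) = ideal_gen t.
Proof. by apply: ideal_val_inj; rewrite ideal_actE ideal_genE (e_id sb). Qed.

Lemma ideal_gen_neq0 t : ideal_gen t != 0.
Proof.
by apply: contraNneq (sb_neq0 sb t) => t0; rewrite -ideal_genE t0 /ideal_val
  linear0.
Qed.

Lemma ideal_top t : exists y : top (idealmod (e t)), simple_gen t y.
Proof.
apply: (@cyclic_top _ (ideal_gen t)); first exact: ideal_gen_e.
  exact: ideal_gen_neq0.
by move=> y; exists (ideal_val y); exact: ideal_genP.
Qed.

End Simple.

(** * Minimal injective coresolutions *)

Section Coresolution.
Context (K : fieldType) (A : falgType K).
Implicit Types M N E X Y Z : rmod A.

(** A minimal injective coresolution of [cosyz 0], cut into short exact sequences. Dimension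
    shifting is passage to the [tail], so inductions on the degree are over all coresolutions. *)
Record coresolution := Coresolution {
  cosyz : nat -> rmod A;
  cterm : nat -> rmod A;
  cemb : forall k, 'Hom(cosyz k, cterm k);
  cproj : forall k, 'Hom(cterm k, cosyz k.+1);
  cterm_inj : forall k, injective_mod (cterm k);
  cemb_hom : forall k, rhom (cemb k);
  cproj_hom : forall k, rhom (cproj k);
  lker_cemb : forall k, lker (cemb k) = 0%VS;
  limg_cproj : forall k, limg (cproj k) = fullv;
  limg_cemb : forall k, limg (cemb k) = lker (cproj k);
  cemb_essential : forall k, essential (limg (cemb k)) }.

Arguments cterm_inj : clear implicits.
Arguments cemb_hom : clear implicits.
Arguments cproj_hom : clear implicits.
Arguments lker_cemb : clear implicits.
Arguments limg_cproj : clear implicits.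
Arguments limg_cemb : clear implicits.
Arguments cemb_essential : clear implicits.

Definition tail C : coresolution :=
  Coresolution (fun k => cterm_inj C k.+1) (fun k => cemb_hom C k.+1)
    (fun k => cproj_hom C k.+1) (fun k => lker_cemb C k.+1)
    (fun k => limg_cproj C k.+1) (fun k => limg_cemb C k.+1) (fun k =>
      cemb_essential C k.+1).

Lemma cproj_cemb C k : (cproj C k \o cemb C k)%VF = 0.
Proof.
apply/lfunP=> x; rewrite comp_lfunE zero_lfunE; apply/eqP.
by rewrite -memv_ker -limg_cemb memv_img ?memvf.
Qed.

Lemma cproj_cembE C k x : cproj C k (cemb C k x) = 0.
Proof. by rewrite -comp_lfunE cproj_cemb zero_lfunE. Qed.

Section Existence.
Context (N0 : rmod A).

Record env_data N := EnvData {
  envE : rmod A;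
  envi : 'Hom(N, envE);
  env_inj : injective_mod envE;
  env_hom : rhom envi;
  env_ker : lker envi = 0%VS;
  env_ess : essential (limg envi) }.

Fact env_ex N : exists _ : env_data N, True.
Proof.
by have [E [i [h1 h2 h3 h4]]] := injective_envelope N; exists (EnvData h1 h2 h3 h4).
Qed.

Definition env N : env_data N := projT1 (cid (env_ex N)).

Definition cosyzygy N : rmod A := quotmod (limg_submod (env_hom (env N))).

(** Transparent, because [cosyz _ 0] has to reduce to [N0]: maps out of [P t] are later typed as
    maps out of the start of its coresolution. *)
Definition min_coresolution : coresolution.
Proof.
pose N k := iter k cosyzygy N0.
apply: (@Coresolution N (fun k => envE (env (N k))) (fun k => envi (env (N k)))
  (fun k => quot_proj (limg (envi (env (N k)))))).
- by move=> k; apply: env_inj.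
- by move=> k; apply: env_hom.
- by move=> k; apply: quot_proj_rhom.
- by move=> k; apply: env_ker.
- by move=> k; apply: limg_quot_proj.
- by move=> k; rewrite lker_quot_proj.
- by move=> k; apply: env_ess.
Defined.

End Existence.

Section Given.
Context (M : rmod A) (I : nat -> rmod A) (eta : 'Hom(M, I 0%N)).
Context (del : forall i, 'Hom(I i, I i.+1)).
Hypothesis (mI : min_inj_coresolution eta del).

Lemma coresolution_of : exists2 C, cosyz C 0 = M & cterm C = I.
Proof.
case: mI => -[injI [h_eta h_del] eta0 ex0 exS] ess0 essS.
pose N k := if k is j.+1 then submod (limg_submod (h_del j)) else M.
pose io k : 'Hom(N k, I k) := match k with
  | 0 => eta | j.+1 => incl (limg_submod (h_del j)) end.
have pr_ex k : exists p : 'Hom(I k, N k.+1), @rhom K A (I k) (N k.+1) p /\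
    forall x, vsval (p x) = del k x.
  by have [p hp pE] := corestrict (limg_submod (h_del k)) (h_del k) (subvv _);
    exists p.
pose pr k := projT1 (cid (pr_ex k)).
have pr_hom k : @rhom K A (I k) (N k.+1) (pr k) by case: (projT2 (cid (pr_ex k))).
have prE k x : vsval (pr k x) = del k x by case: (projT2 (cid (pr_ex k))).
have pr_ker k : lker (pr k) = lker (del k).
  apply/vspaceP=> x; rewrite !memv_ker -prE.
  apply/eqP/eqP => [-> | h]; first by rewrite linear0.
  by apply: subvs_inj; rewrite h linear0.
have io_img k : limg (io k) = lker (del k).
  by case: k => [|k] //; rewrite /io limg_incl exS.
have io_hom k : @rhom K A (N k) (I k) (io k).
  by case: k => [|k] //; apply: incl_rhom.
have io_ker k : lker (io k) = 0%VS by case: k => [|k] //; apply: lker_incl.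
have pr_img k : limg (pr k) = fullv.
  apply/vspaceP=> y; rewrite memvf.
  have /memv_imgP [x _ yx] := subvsP y; apply/memv_imgP.
  by exists x; rewrite ?memvf //; apply: subvs_inj; rewrite prE.
have exact k : limg (io k) = lker (pr k) by rewrite pr_ker io_img.
have ess k : essential (limg (io k)).
  by case: k {exact} => [|k] //; rewrite /io limg_incl.
by exists (Coresolution injI io_hom pr_hom io_ker pr_img exact ess).
Qed.

End Given.

Definition chain_step C C' (f : 'Hom(cosyz C 0, cosyz C' 0)) (f' : 'Hom(cosyz C
  1, cosyz C' 1)) :=
  [/\ rhom f, rhom f' & exists2 p : 'Hom(cterm C 0, cterm C' 0), rhom p &
     (p \o cemb C 0 = cemb C' 0 \o f)%VF /\ (f' \o cproj C 0 = cproj C' 0 \o p)%VF].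

(* [g] is the map induced on [k]-th cosyzygies by a morphism of coresolutions
   extending [f]; it is not unique. *)
Fixpoint chain_lift k C C' :
    'Hom(cosyz C 0, cosyz C' 0) -> 'Hom(cosyz C k, cosyz C' k) -> Prop :=
  match k with
  | 0 => fun f g => rhom f /\ f = g
  | j.+1 => fun f g => exists2 f1, chain_step f f1 & @chain_lift j (tail C)
    (tail C') f1 g
  end.

Lemma chain_step_ex C C' (f : 'Hom(cosyz C 0, cosyz C' 0)) : rhom f -> exists
  f', chain_step f f'.
Proof.
move=> hf.
have [p hp pE] := cterm_inj C' 0 _ _ _ _ (cemb_hom C 0) (lker_cemb C 0)
  (rhom_comp hf (cemb_hom C' 0)).
have [|f' hf' fE] := factor_epi (cproj_hom C 0) (rhom_comp hp (cproj_hom C' 0))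
  (limg_cproj C 0).
  rewrite -limg_cemb; apply/subvP=> _ /memv_imgP [x _ ->]; rewrite memv_ker.
  by rewrite comp_lfunE -[p _]comp_lfunE pE comp_lfunE cproj_cembE.
by exists f'; split=> //; exists p.
Qed.

Lemma chain_lift_ex k C C' (f : 'Hom(cosyz C 0, cosyz C' 0)) :
  rhom f -> exists g, @chain_lift k C C' f g.
Proof.
elim: k C C' f => [|k IH] C C' f hf; first by exists f.
have [f1 hf1] := chain_step_ex hf; case: (hf1) => _ h1 _.
have [g hg] := IH (tail C) (tail C') f1 h1.
by exists g, f1.
Qed.

Lemma chain_lift_hom k C C' f g : @chain_lift k C C' f g -> rhom f /\ rhom g.
Proof.
elim: k C C' f g => [|k IH] C C' f g /=; first by case=> hf <-.
by case=> f1 [hf hf1 _] /IH [_ hg].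
Qed.

Lemma chain_step_comp C C' C'' (f : 'Hom(cosyz C 0, cosyz C' 0)) f1
   (g : 'Hom(cosyz C' 0, cosyz C'' 0)) g1 :
  chain_step f f1 -> chain_step g g1 -> @chain_step C C'' (g \o f)%VF (g1 \o f1)%VF.
Proof.
case=> hf hf1 [p hp [pE pE']] [hg hg1 [q hq [qE qE']]].
split; [exact: rhom_comp | exact: rhom_comp |exists (q \o p)%VF].
  exact: rhom_comp.
split; first by rewrite -comp_lfunA pE !comp_lfunA qE.
by rewrite -comp_lfunA pE' !comp_lfunA qE'.
Qed.

Lemma chain_lift_comp k C C' C'' (f : 'Hom(cosyz C 0, cosyz C' 0)) f1
   (g : 'Hom(cosyz C' 0, cosyz C'' 0)) g1 :
  chain_lift f f1 -> chain_lift g g1 -> @chain_lift k C C'' (g \o f)%VF (g1 \o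
    f1)%VF.
Proof.
elim: k C C' C'' f f1 g g1 => [|k IH] C C' C'' f f1 g g1 /=.
  by case=> hf <- [hg <-]; split=> //; apply: rhom_comp.
case=> f2 ff2 ff1 [g2 gg2 gg1]; exists (g2 \o f2)%VF; first exact: chain_step_comp.
exact: IH ff1 gg1.
Qed.

Lemma chain_step_id C : @chain_step C C \1%VF \1%VF.
Proof.
split; [exact: rhom_id | exact: rhom_id | exists \1%VF; first exact: rhom_id].
by rewrite !comp_lfun1l !comp_lfun1r.
Qed.

Lemma chain_lift_id k C : @chain_lift k C C \1%VF \1%VF.
Proof.
elim: k C => [|k IH] C /=; first by split; first exact: rhom_id.
by exists \1%VF; [exact: chain_step_id | exact: IH].
Qed.

Lemma chain_step_lin a C C' (f g : 'Hom(cosyz C 0, cosyz C' 0)) f1 g1 :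
  chain_step f f1 -> chain_step g g1 -> @chain_step C C' (a *: f + g) (a *: f1
    + g1).
Proof.
case=> hf hf1 [p hp [pE pE']] [hg hg1 [q hq [qE qE']]].
split; [exact/rhomD/hg/rhomZ | exact/rhomD/hg1/rhomZ | exists (a *: p + q)].
  exact/rhomD/hq/rhomZ.
by rewrite !comp_lfunDl !comp_lfunDr -!comp_lfunZl -!comp_lfunZr pE qE pE' qE'.
Qed.

Lemma chain_lift_lin k a C C' (f g : 'Hom(cosyz C 0, cosyz C' 0)) f1 g1 :
  chain_lift f f1 -> chain_lift g g1 -> @chain_lift k C C' (a *: f + g) (a *:
    f1 + g1).
Proof.
elim: k C C' f f1 g g1 => [|k IH] C C' f f1 g g1 /=.
  by case=> hf <- [hg <-]; split=> //; apply/rhomD/hg/rhomZ.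
case=> f2 ff2 ff1 [g2 gg2 gg1]; exists (a *: f2 + g2); first exact: chain_step_lin.
exact: IH ff1 gg1.
Qed.

End Coresolution.

Arguments cterm_inj {K A} C k : rename.
Arguments cemb_hom {K A} C k : rename.
Arguments cproj_hom {K A} C k : rename.
Arguments lker_cemb {K A} C k : rename.
Arguments limg_cproj {K A} C k : rename.
Arguments limg_cemb {K A} C k : rename.
Arguments cemb_essential {K A} C k : rename.

Section Null.
Context (K : fieldType) (A : falgType K) (n : nat) (e : 'I_n -> A).
Context (J : {vspace A}) (sb : split_basic e J).
Implicit Types M N E X Y Z : rmod A.
Implicit Types C : coresolution A.

(* Stands for 'null-homotopic': in positive degrees, the indeterminacy of
   [chain_lift] consists of such maps. *)
Definition null_map M N (f : 'Hom(M, N)) : Prop :=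
  exists E (s : 'Hom(M, E)) (p : 'Hom(E, N)),
    [/\ injective_mod E, rhom s, rhom p, f = (p \o s)%VF &
        forall j x, x \in socle e J E j -> p x = 0].

Lemma null_map_socle M N (f : 'Hom(M, N)) j x :
  null_map f -> x \in socle e J M j -> f x = 0.
Proof.
by case=> E [s [p [_ hs hp -> p0]]] xs; rewrite comp_lfunE (p0 j) // socle_img.
Qed.

(** The socle of an injective envelope lies in the enveloped module, which is the kernel of
    [cproj C k]. *)
Lemma cproj_socle C k j x : x \in socle e J (cterm C k) j -> cproj C k x = 0.
Proof.
move=> xs; have := essential_socle sb (cemb_essential C k) xs.
by rewrite limg_cemb memv_ker => /eqP.
Qed.

(* When [f] is null, it also has an extension [q] to the middle terms that
   [cproj] kills; the given extension differs from [q] by a map killing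
   [cosyz C 0]. *)
Lemma chain_step_null C C' (f : 'Hom(cosyz C 0, cosyz C' 0)) f' :
  chain_step f f' -> (f = 0 \/ null_map f) -> null_map f'.
Proof.
case=> hf hf' [p hp [pE pE']] nf.
have [q hq [qE qpr]] : exists2 q : 'Hom(cterm C 0, cterm C' 0), rhom q &
    (q \o cemb C 0 = cemb C' 0 \o f)%VF /\ (cproj C' 0 \o q)%VF = 0.
  case: nf => [->|[E [s [r [injE hs hr -> _]]]]].
    by exists 0; rewrite ?comp_lfun0l ?comp_lfun0r //; apply: rhom0.
  have [t ht tE] := injE _ _ _ _ (cemb_hom C 0) (lker_cemb C 0) hs.
  exists (cemb C' 0 \o (r \o t))%VF.
    by apply: rhom_comp (cemb_hom _ _); apply: rhom_comp.
  split; last by rewrite comp_lfunA cproj_cemb comp_lfun0l.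
  by rewrite -!comp_lfunA tE.
have [|u hu uE] := factor_epi (cproj_hom C 0) (rhomB hp hq) (limg_cproj C 0).
  rewrite -limg_cemb; apply/subvP=> _ /memv_imgP [x _ ->]; rewrite memv_ker.
  by rewrite sub_lfunE -!comp_lfunE pE qE subrr.
exists (cterm C' 0), u, (cproj C' 0); split=> //.
- exact: cterm_inj.
- exact: cproj_hom.
- apply/lfunP=> y; case: (limg_fullP y (limg_cproj C 0)) => x <-.
  rewrite -[f' _]comp_lfunE pE' !comp_lfunE -[u _]comp_lfunE uE sub_lfunE
    linearB /=.
  by rewrite -[cproj C' 0 (q x)]comp_lfunE qpr zero_lfunE subr0.
- by move=> j x; apply: cproj_socle.
Qed.

Lemma chain_lift_null k C C' f g : @chain_lift K A k C C' f g -> null_map f ->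
  null_map g.
Proof.
elim: k C C' f g => [|k IH] C C' f g /=; first by case=> _ <-.
case=> f1 ff1 f1g nf; apply: IH f1g _; apply: chain_step_null ff1 _; by right.
Qed.

(** Since lifts add, this says that all lifts of one map agree on socles. *)
Lemma chain_lift0_socle k C C' g j x : @chain_lift K A k C C' 0 g ->
  x \in socle e J (cosyz C k) j -> g x = 0.
Proof.
case: k C C' g x => [|k] C C' g x /=; first by case=> _ <-; rewrite zero_lfunE.
case=> f1 ff1 f1g; apply: null_map_socle; apply: chain_lift_null f1g _.
by apply: chain_step_null ff1 _; left.
Qed.

End Null.

(** * Projective dimension and lifting maps backwards *)

Section Vanishing.
Context (K : fieldType) (A : falgType K).
Implicit Types M N E X Y Z : rmod A.
Implicit Types C : coresolution A.

(* Equivalent to [pdim X <= k]: by dimension shifting along [C], it says that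
   [Ext^(k+1)(X, cosyz C 0)] vanishes for every [C]. *)
Definition ext_vanish X k : Prop :=
  forall C (h : 'Hom(X, cosyz C k.+1)), rhom h ->
    exists2 h' : 'Hom(X, cterm C k), rhom h' & (cproj C k \o h')%VF = h.

Lemma ext_vanishS X k : ext_vanish X k -> ext_vanish X k.+1.
Proof. by move=> v C h hh; apply: (v (tail C)). Qed.

Lemma ext_vanish_le X k l : (k <= l)%N -> ext_vanish X k -> ext_vanish X l.
Proof.
move=> /subnK <-; elim: (l - k)%N => [|m IH] // v; rewrite addSn.
exact/ext_vanishS/IH.
Qed.

Lemma ext_vanish_retract X Y k (i : 'Hom(X, Y)) (r : 'Hom(Y, X)) :
  rhom i -> rhom r -> (r \o i)%VF = \1%VF -> ext_vanish Y k -> ext_vanish X k.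
Proof.
move=> hi hr ri v C h hh; have [h' hh' hE] := v C _ (rhom_comp hr hh).
exists (h' \o i)%VF; first exact: rhom_comp.
by rewrite comp_lfunA hE -comp_lfunA ri comp_lfun1r.
Qed.

(** Lifting the identity splits [cproj C k]; the image of the section meets the essential kernel
    trivially, so it is zero. *)
Lemma ext_vanish_dim0 C k : ext_vanish (cosyz C k.+1) k -> \dim {: cosyz C
  k.+1} = 0%N.
Proof.
case/(_ C _ (@rhom_id _ _ _)) => s hs sE.
have s0 : limg s = 0%VS.
  apply: (cemb_essential C k _ (limg_submod hs)); apply/eqP; rewrite -subv0.
  apply/subvP=> y /memv_capP [iy /memv_imgP [x _ yx]].
  rewrite yx in iy *; move: iy; rewrite limg_cemb memv_ker -comp_lfunE sE
    id_lfunE => /eqP ->.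
  by rewrite linear0 mem0v.
rewrite -(@limg_dim_eq _ _ _ s) ?s0 ?dimv0 //; apply/eqP; rewrite -subv0;
  apply/subvP=> x /memv_capP [_].
by rewrite memv_ker => /eqP sx; rewrite -(id_lfunE x) -sE comp_lfunE sx linear0
  mem0v.
Qed.

Lemma pdim_ext_vanish X d : pdim_le X d -> ext_vanish X d.
Proof.
case=> P [eps [del [[prP [h_eps h_del] eps1 ex0 exS] P0]]].
(* Cocycles on the projective resolution are lifted while still being cocycles, going down from
   degree [d], where the condition is void because the next term is zero. At degree 0 a cocycle
   descends to [X]. *)
have key m : (m <= d)%N -> forall C (h : 'Hom(P (d - m)%N, cosyz C m.+1)),
    @rhom K A (P (d - m)%N) (cosyz C m.+1) h -> (h \o del (d - m)%N)%VF = 0 ->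
    exists2 h' : 'Hom(P (d - m)%N, cterm C m), @rhom K A (P (d - m)%N) (cterm C
      m) h' &
      (cproj C m \o h')%VF = h /\ (h' \o del (d - m)%N)%VF = 0.
  elim: m => [|m IH] md C h hh hd.
    rewrite subn0 in h hh hd *.
    have [|h' hh' hE] := proj_lift (prP d) (cproj_hom C 0) hh.
      by rewrite limg_cproj subvf.
    exists h' => //; split=> //; apply/lfunP=> x; rewrite zero_lfunE.
    suff -> : x = 0 by rewrite linear0.
    apply/eqP; rewrite -memv0 (_ : 0%VS = fullv) ?memvf //; apply/esym/eqP.
    by rewrite -dimv_eq0 P0.
  have dm : (d - m)%N = (d - m.+1).+1 by rewrite subnSK.
  have {}IH := IH (ltnW md); rewrite dm in IH.
  move: (d - m.+1)%N h hh hd IH => k h hh hd IH.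
  have [|p hp pE] := proj_lift (prP k) (cproj_hom C m.+1) hh.
    by rewrite limg_cproj subvf.
  have [|g hg gE] := factor_mono (cemb_hom C m.+1)
      (rhom_comp (h_del k) hp) (lker_cemb C m.+1).
    rewrite limg_cemb; apply/subvP=> _ /memv_imgP [x _ ->].
    by rewrite memv_ker -comp_lfunE comp_lfunA pE hd zero_lfunE.
  have [|g' hg' [gE' gd']] := IH C g hg.
    apply/lfunP=> x; rewrite zero_lfunE; apply: (lker0_eq (lker_cemb C m.+1)).
    rewrite comp_lfunE -[cemb _ _ _]comp_lfunE gE comp_lfunE -[del k _]comp_lfunE.
    suff -> : (del k \o del k.+1)%VF = 0 by rewrite zero_lfunE linear0.
    apply/lfunP=> y; rewrite zero_lfunE comp_lfunE; apply/eqP.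
    by rewrite -memv_ker -exS memv_img ?memvf.
  have [|q hq qE] := inj_extend (cterm_inj C m) (h_del k) hg'.
    rewrite -exS; apply/subvP=> _ /memv_imgP [x _ ->].
    by rewrite memv_ker -comp_lfunE gd' zero_lfunE.
  (* [p] lifts [h] but need not be a cocycle; its defect is the image of [g = cproj C m \o g'], and
     [w], built from an extension [q] of [g'], removes it without changing the projection. *)
  pose w := (cemb C m.+1 \o (cproj C m \o q))%VF.
  have hw : rhom w.
    by apply: rhom_comp (cemb_hom C _); apply: rhom_comp (cproj_hom C _).
  exists (p - w); first exact: rhomB.
  split; apply/lfunP=> x.
    by rewrite comp_lfunE sub_lfunE linearB /= /w comp_lfunE cproj_cembE subr0
      -comp_lfunE pE.
  rewrite comp_lfunE sub_lfunE zero_lfunE -[p _]comp_lfunE -gE -gE'.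
  by rewrite -qE /w !comp_lfunE subrr.
move=> C h hh; have := key d (leqnn d) C; rewrite subnn => {}key.
have [|g hg [gE gd]] := key (h \o eps)%VF (rhom_comp h_eps hh).
  apply/lfunP=> x; rewrite zero_lfunE -comp_lfunA comp_lfunE.
  suff -> : (eps \o del 0%N)%VF x = 0 by rewrite linear0.
  by rewrite comp_lfunE; apply/eqP; rewrite -memv_ker -ex0 memv_img ?memvf.
have [|h' hh' hE] := factor_epi h_eps hg eps1.
  rewrite -ex0; apply/subvP=> _ /memv_imgP [x _ ->].
  by rewrite memv_ker -comp_lfunE gd zero_lfunE.
exists h' => //; apply/lfunP=> y; case: (limg_fullP y eps1) => x <-.
by rewrite -!comp_lfunE -comp_lfunA hE gE.
Qed.

Lemma chain_step_back C C' (h : 'Hom(cosyz C 1, cosyz C' 1)) :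
  (forall g : 'Hom(cterm C 0, cosyz C' 1), rhom g ->
     exists2 g' : 'Hom(cterm C 0, cterm C' 0), rhom g' & (cproj C' 0 \o g')%VF
       = g) ->
  rhom h -> exists f, chain_step f h.
Proof.
move=> v hh; have [p hp pE] := v _ (rhom_comp (cproj_hom C 0) hh).
have [|f hf fE] := factor_mono (cemb_hom C' 0) (rhom_comp (cemb_hom C 0) hp)
  (lker_cemb C' 0).
  rewrite limg_cemb; apply/subvP=> _ /memv_imgP [x _ ->].
  by rewrite memv_ker -comp_lfunE comp_lfunA pE -comp_lfunA cproj_cemb
    comp_lfun0r zero_lfunE.
by exists f; split=> //; exists p.
Qed.

(** The hypothesis is stated against [C'] and not as [ext_vanish (cterm C j) j], which [tail C] does
    not inherit: its degrees are shifted by one. *)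
Lemma chain_lift_back k C C' (h : 'Hom(cosyz C k, cosyz C' k)) :
  (forall j (g : 'Hom(cterm C j, cosyz C' j.+1)), (j < k)%N -> rhom g ->
     exists2 g' : 'Hom(cterm C j, cterm C' j), rhom g' & (cproj C' j \o g')%VF
       = g) ->
  rhom h -> exists f, chain_lift f h.
Proof.
elim: k C C' h => [|k IH] C C' h v hh; first by exists h.
have [j g jk hg|f1 f1h] := IH (tail C) (tail C') h _ hh; first exact: (v j.+1).
have [hf1 _] := chain_lift_hom f1h.
have [g hg|f ff1] := chain_step_back _ hf1; first exact: (v 0%N).
by exists f, f1.
Qed.

End Vanishing.

Section LPow.
Context (K : fieldType) (A : falgType K).
Implicit Types M : rmod A.

Definition lpow (V : vectType K) (f : 'End(V)) m : 'End(V) :=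
  iter m (fun g => (f \o g)%VF) \1%VF.

Lemma lpowS (V : vectType K) (f : 'End(V)) m x : lpow f m.+1 x = f (lpow f m x).
Proof. by rewrite /lpow /= comp_lfunE. Qed.

Lemma lpow_eigen (V : vectType K) (f : 'End(V)) m c x :
  f x = c *: x -> lpow f m x = c ^+ m *: x.
Proof.
move=> fx; elim: m => [|m IH]; first by rewrite /lpow /= id_lfunE scale1r.
by rewrite lpowS IH linearZ /= fx scalerA exprSr.
Qed.

Lemma chain_lift_lpow k (C : coresolution A) (f : 'End(cosyz C 0)) g m :
  chain_lift (k := k) f g -> chain_lift (k := k) (lpow f m) (lpow g m).
Proof.
move=> fg; elim: m => [|m IH]; first exact: chain_lift_id.
exact: chain_lift_comp IH fg.
Qed.

End LPow.

Section CoresolutionDim.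
Context (K : fieldType) (A : falgType K) (C : coresolution A).

Lemma dim0_eq0 (V : vectType K) (x : V) : \dim {: V} = 0%N -> x = 0.
Proof.
by move/eqP; rewrite dimv_eq0 => /eqP V0; apply/eqP; rewrite -memv0 -V0 memvf.
Qed.

Lemma cterm_dim0 k : \dim {: cosyz C k} = 0%N -> \dim {: cterm C k} = 0%N.
Proof.
move=> N0; apply/eqP; rewrite dimv_eq0; apply/eqP; apply: (cemb_essential C k).
  by move=> a x _; exact: memvf.
apply/eqP; rewrite -subv0; apply/subvP=> _ /memv_capP [/memv_imgP [x _ ->] _].
by rewrite (dim0_eq0 x N0) linear0 mem0v.
Qed.

Lemma cosyz_dim0S k : \dim {: cosyz C k} = 0%N -> \dim {: cosyz C k.+1} = 0%N.
Proof.
move/cterm_dim0 => E0; apply/eqP; rewrite dimv_eq0 -subv0; apply/subvP=> y _.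
have [x <-] := limg_fullP y (limg_cproj C k).
by rewrite (dim0_eq0 x E0) linear0 mem0v.
Qed.

Lemma cosyz_dim0_le k l : (k <= l)%N -> \dim {: cosyz C k} = 0%N -> \dim {:
  cosyz C l} = 0%N.
Proof.
move=> /subnK <-; elim: (l - k)%N => [|m IH] // v; rewrite addSn.
exact/cosyz_dim0S/IH.
Qed.

(** Here the embedding into the envelope is onto, so the last nonzero cosyzygy can stand for the
    last term. *)
Lemma cosyz_injective k : \dim {: cosyz C k.+1} = 0%N -> injective_mod (cosyz C k).
Proof.
move=> N0; have f1 : limg (cemb C k) = fullv.
  rewrite limg_cemb; apply/vspaceP=> x; rewrite memvf memv_ker.
  by rewrite (dim0_eq0 (cproj C k x) N0) eqxx.
have [|r hr rE] := factor_mono (cemb_hom C k) (@rhom_id _ _ _) (lker_cemb C k).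
  by rewrite f1 subvf.
apply: (injective_retract (cterm_inj C k) (cemb_hom C k) hr).
apply: lker0_cond => x; rewrite comp_lfunE => rx.
apply: (lker0_eq (lker_cemb C k)).
by rewrite -(id_lfunE (cemb C k x)) -rE comp_lfunE rx linear0.
Qed.

End CoresolutionDim.

Section IdealHom.
Context (K : fieldType) (A : falgType K) (n : nat) (e : 'I_n -> A).
Context (J : {vspace A}) (sb : split_basic e J).
Local Notation P t := (idealmod (e t)).

Lemma socle_index M i j (x : rcar M) :
  x \in socle e J M i -> x \in socle e J M j -> x != 0 -> i = j.
Proof.
move=> /socleP [xi _] /socleP [xj _]; apply: contraNeq => ij.
by rewrite -xj -{1}xi ractA (sb_orth sb) (negPf ij) ract0.
Qed.

(** Maps [e_u A -> e_t A] are left multiplications by elements of [e_t A e_u], namely by the image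
    of [e_u]. *)
Lemma ideal_hom u t (f : 'Hom(P u, P t)) : rhom f ->
  exists2 a : A, a = e t * a * e u & forall y, ideal_val (f y) = a * ideal_val y.
Proof.
move=> hf; pose a := ideal_val (f (ideal_gen e u)).
have aE y : ideal_val (f y) = a * ideal_val y.
  by rewrite {1}(ideal_genP sb y) hf ideal_actE.
exists a => //; have [b ab] := ideal_valP (f (ideal_gen e u)).
have -> : e t * a = a by rewrite /a ab mulrA (e_id sb).
by rewrite -(ideal_genE sb u) -aE.
Qed.

Lemma ideal_endo_nilp t (f : 'Hom(P t, P t)) a : a \in J ->
  (forall y, ideal_val (f y) = a * ideal_val y) -> exists m, lpow f m = 0.
Proof.
move=> Ja fE; have [m am] := J_nilpotent sb Ja; exists m.
have key k y : ideal_val (lpow f k y) = a ^+ k * ideal_val y.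
  elim: k => [|k IH]; first by rewrite /lpow /= id_lfunE mul1r.
  by rewrite lpowS fE IH exprS mulrA.
apply/lfunP=> y; apply: ideal_val_inj.
by rewrite key am mul0r zero_lfunE /ideal_val linear0.
Qed.

Lemma ideal_endo_split t (f : 'Hom(P t, P t)) : rhom f ->
  exists c m, lpow (f - c *: \1)%VF m = 0.
Proof.
move=> hf; have [a aE fE] := ideal_hom hf.
have [c Jc] := e_mul_split sb t a; exists c.
rewrite -aE in Jc; apply: (ideal_endo_nilp Jc) => y.
rewrite sub_lfunE scale_lfunE id_lfunE mulrBl -fE -scalerAl.
have [b yb] := ideal_valP y; rewrite [in RHS]yb mulrA (e_id sb) -yb.
by rewrite /ideal_val linearB linearZ.
Qed.

Lemma ideal_comp_nilp t u (f : 'Hom(P t, P u)) (g : 'Hom(P u, P t)) :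
  rhom f -> rhom g -> t != u -> exists m, lpow (g \o f)%VF m = 0.
Proof.
move=> hf hg tu; have [a _ fE] := ideal_hom hf; have [b bE gE] := ideal_hom hg.
apply: (@ideal_endo_nilp _ _ (b * a)) => [|y]; last first.
  by rewrite comp_lfunE gE fE mulrA.
by apply: (sb_mulr sb); rewrite bE; apply: (e_mul_offdiag sb).
Qed.

End IdealHom.

(** * The Cartan matrix *)

Section Cartan.
Context (K : fieldType) (A : falgType K) (n : nat) (e : 'I_n -> A).
Context (J : {vspace A}) (sb : split_basic e J).
Local Notation P t := (idealmod (e t)).

(** The multiplicity of [S(i)] as a composition factor of [M]; [soc_dim] below is the dimension of
    [Hom(S(j), M)]. *)
Definition dimv_at (M : rmod A) i : nat := \dim (limg (ract M (e i))).
Definition soc_dim (M : rmod A) j : nat := \dim (socle e J M j).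

Lemma mem_limg_e (M : rmod A) i x :
  (x \in limg (ract M (e i))) = (ract M (e i) x == x).
Proof.
apply/memv_imgP/eqP => [[y _ ->]|xe]; last by exists x; rewrite ?memvf.
by rewrite ractA (e_id sb).
Qed.

Lemma submod_add_line (M : rmod A) (U : {vspace M}) x j : is_submod U ->
  ract M (e j) x = x -> (forall a, a \in J -> ract M a x \in U) ->
  @is_submod _ _ M (U + <[x]>)%VS.
Proof.
move=> hU xe xJ a y /memv_addP [u Uu [_ /vlineP [c ->] ->]].
rewrite linearD linearZ /=; apply: memvD; first exact/(subvP (addvSl _ _))/hU.
apply: memvZ; have [d Jd] := sb_split sb a.
rewrite -[a](subrK (\sum_i d i *: e i)) ractD memvD //.
  exact/(subvP (addvSl _ _))/xJ.
rewrite ract_sum memv_suml // => i _; rewrite ractZ memvZ //.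
rewrite -{1}xe ractA (sb_orth sb); case: eqP => [_|_]; last by rewrite ract0 mem0v.
by apply/(subvP (addvSr _ _)); rewrite xe memv_line.
Qed.

Lemma e_fix_orth (M : rmod A) i j (x : M) :
  ract M (e j) x = x -> i != j -> ract M (e i) x = 0.
Proof.
by move=> xe ij; rewrite -xe ractA (sb_orth sb) eq_sym (negPf ij) ract0.
Qed.

Lemma dim_add_line (V : vectType K) (U : {vspace V}) x :
  x \notin U -> \dim (U + <[x]>) = (\dim U).+1.
Proof.
move=> Ux; rewrite dimv_disjoint_sum ?dim_vline.
  by rewrite (_ : x != 0) ?addn1 //; apply: contraNneq Ux => ->; rewrite mem0v.
apply/eqP; rewrite -subv0; apply/subvP=> y /memv_capP [Uy /vlineP [c yc]].
rewrite yc; case: (eqVneq c 0) => [->|c0]; first by rewrite scale0r mem0v.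
by case/negP: Ux; rewrite -(scalerK c0 x) -yc memvZ.
Qed.

Section Annihilator.
Context (E : rmod A) (injE : injective_mod E) (t : 'I_n).

(* The annihilator of [U] in [E] is [Hom(P t / U, E)]. *)
Definition ann (U : {vspace P t}) : {vspace E} :=
  subspace_of (fun z : E => ract E (e t) z = z /\
    forall u, u \in U -> ract E (ideal_val u) z = 0).

Lemma annP U z : z \in ann U <->
  ract E (e t) z = z /\ forall u, u \in U -> ract E (ideal_val u) z = 0.
Proof.
apply: subspace_ofP; split=> [|k u v [u1 u2] [v1 v2]].
  by split=> [|a _]; rewrite linear0.
by split=> [|a Ja]; rewrite linearP /= ?u1 ?v1 // u2 // v2 // scaler0 addr0.
Qed.

(** The exact functor [Hom(-, E)] applied to [0 -> S(j) -> P t / U -> P t / (U + K x) -> 0]; the map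
    to [Hom(S(j), E)] is evaluation at [x]. *)
Lemma ann_step (U : {vspace P t}) j (x : P t) : is_submod U -> x \notin U ->
  ract (P t) (e j) x = x -> (forall a, a \in J -> ract (P t) a x \in U) ->
  \dim (ann U) = (\dim (ann (U + <[x]>)) + soc_dim E j)%N.
Proof.
move=> hU Ux xe xJ; pose f := ract E (ideal_val x).
rewrite /soc_dim -(limg_ker_dim f (ann U)); congr (_ + _)%N; congr (\dim _).
  apply/vspaceP=> z; rewrite memv_cap memv_ker; apply/andP/idP.
    case=> /annP [ze zU] /eqP zx; apply/annP; split=> // u.
    case/memv_addP=> u1 /zU u10 [_ /vlineP [c ->] ->].
    by rewrite /ideal_val linearD linearZ /= ractD ractZ u10 zx scaler0 addr0.
  case/annP=> ze zU; split.
    by apply/annP; split=> // u Uu; apply: zU; apply: (subvP (addvSl _ _)).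
  by apply/eqP/zU/(subvP (addvSr _ _))/memv_line.
apply/vspaceP=> w; apply/memv_imgP/idP => [[z /annP [ze zU] ->]|ws].
  apply/socleP; rewrite /f ractA -ideal_actE xe; split=> // a Ja.
  by rewrite ractA -ideal_actE; apply/zU/xJ.
pose q : 'Hom(P t, quotmod hU) := quot_proj U.
have hq : rhom q by exact: quot_proj_rhom.
have q0 y : (q y == 0) = (y \in U) by exact: quot_proj0.
have qs : q x \in socle e J (quotmod hU) j.
  apply/socleP; split=> [|a Ja]; rewrite -hq ?xe //.
  by apply/eqP; rewrite q0 xJ.
have [|g hg gx] := socle_extend sb injE qs _ ws; first by rewrite q0.
have gE u : ract E (ideal_val u) (g (q (ideal_gen e t))) = g (q u).
  by rewrite -hg -hq -(ideal_genP sb).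
exists (g (q (ideal_gen e t))); last by rewrite /f gE gx.
apply/annP; split=> [|u Uu].
  by rewrite -{1}(ideal_genE sb t) gE.
by rewrite gE (_ : q u = 0) ?linear0 //; apply/eqP; rewrite q0.
Qed.

(** Induction on the codimension of [U], one composition factor at a time. The multiplicities in [U]
    stand on the left to avoid truncated subtraction. *)
Lemma dim_ann (U : {vspace P t}) : is_submod U ->
  (\dim (ann U) + \sum_j \dim (ract (P t) (e j) @: U)%VS * soc_dim E j =
   \sum_j dimv_at (P t) j * soc_dim E j)%N.
Proof.
have [m] := ubnP (\dim {: P t} - \dim U); elim: m U => // m IH U dU hU.
have [/eqP -> | nU] := boolP (U == fullv).
  suff -> : ann fullv = 0%VS by rewrite dimv0 add0n.
  apply/eqP; rewrite -subv0; apply/subvP=> z /annP [ze /(_ (ideal_gen e t)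
    (memvf _))].
  by rewrite (ideal_genE sb) ze => ->; rewrite mem0v.
have [||j [x [_ Ux] [xe xJ]]] := @socle_rel _ _ _ _ _ sb (P t) U fullv hU.
- by move=> a x _; exact: memvf.
- by apply: contra nU => fU; rewrite eqEsubv subvf.
have hU' := submod_add_line hU xe xJ.
have {}IH := IH _ _ hU'.
rewrite -IH; last first.
  have : (\dim U < \dim {: P t})%N.
    rewrite ltn_neqAle dimvS ?subvf // andbT; apply: contra nU.
    by rewrite eqEdim subvf /= => /eqP ->.
  by rewrite dim_add_line //; move: dU; lia.
rewrite (ann_step hU Ux xe xJ) -addnA; congr (_ + _)%N.
rewrite (bigD1 j) //= [in RHS](bigD1 j) //= addnA; congr (_ + _)%N.
  rewrite limgD limg_line xe dim_add_line ?mulSn //.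
  apply: contra Ux => /memv_imgP [u Uu ->]; exact: hU.
apply: eq_bigr => i ij; congr (\dim _ * _)%N.
have -> : (ract (P t) (e i) @: (U + <[x]>) = ract (P t) (e i) @: U)%VS.
  by rewrite limgD limg_line (e_fix_orth xe) // addv0.
by [].
Qed.

(** The case [U = 0], where the annihilator is [E e_t], that is, [Hom(P t, E)]. *)
Lemma dim_injective_corner :
  dimv_at E t = (\sum_j dimv_at (P t) j * soc_dim E j)%N.
Proof.
have := dim_ann (@submod0 _ _ (P t)); rewrite [X in (_ + X)%N]big1; last first.
  by move=> j _; rewrite limg0 dimv0 mul0n.
rewrite addn0 => <-; congr (\dim _); apply/vspaceP=> z; rewrite mem_limg_e.
apply/eqP/idP => [ze|/annP [] //]; apply/annP; split=> // u.
by rewrite memv0 => /eqP ->; rewrite /ideal_val linear0 ract0.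
Qed.

End Annihilator.

Lemma dimv_at_cterm (C : coresolution A) k i :
  dimv_at (cterm C k) i = (dimv_at (cosyz C k) i + dimv_at (cosyz C k.+1) i)%N.
Proof.
rewrite /dimv_at -(limg_ker_dim (cproj C k) (limg (ract (cterm C k) (e i)))).
congr addn.
  rewrite -(@limg_dim_eq _ _ _ (cemb C k) (limg _)); last by rewrite lker_cemb
    capv0.
  congr (\dim _); apply/vspaceP=> x; rewrite memv_cap mem_limg_e -limg_cemb.
  apply/andP/memv_imgP => [[xe /memv_imgP [y _ xy]]|[y ye ->]]; last first.
    move: ye; rewrite mem_limg_e => /eqP ye.
    by rewrite -cemb_hom ye eqxx memv_img ?memvf.
  exists y => //; rewrite mem_limg_e -subr_eq0; apply/eqP/(lker0_eq (lker_cemb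
    C k)).
  by rewrite linearB /= cemb_hom -xy (eqP xe) subrr.
congr (\dim _); apply/vspaceP=> y; rewrite mem_limg_e; apply/memv_imgP/eqP.
  by case=> x; rewrite mem_limg_e => /eqP xe ->; rewrite -cproj_hom xe.
have [x <-] := limg_fullP y (limg_cproj C k) => ye.
exists (ract (cterm C k) (e i) x); last by rewrite cproj_hom ye.
by rewrite mem_limg_e ractA (e_id sb).
Qed.

(** An essential extension adds nothing to the socle. *)
Lemma soc_dim_cterm (C : coresolution A) k j : soc_dim (cterm C k) j = soc_dim
  (cosyz C k) j.
Proof.
rewrite /soc_dim -(@limg_dim_eq _ _ _ (cemb C k) (socle _ _ (cosyz C k) j));
  last first.
  by rewrite lker_cemb capv0.
congr (\dim _); apply/vspaceP=> x; apply/idP/memv_imgP => [xs|[y ys ->]]; last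
  first.
  exact: socle_img (cemb_hom C k) ys.
have /memv_imgP [y _ xy] := essential_socle sb (cemb_essential C k) xs.
exists y => //; have /socleP [xe xJ] := xs; apply/socleP.
split=> [|a Ja]; apply/eqP; rewrite -subr_eq0 ?subr0; apply/eqP/(lker0_eq
  (lker_cemb C k)).
  by rewrite linearB /= cemb_hom -xy xe subrr.
by rewrite cemb_hom -xy xJ.
Qed.

(** By minimality the [k]-th summand is, up to sign, the dimension of [Ext^k(S(j), cosyz C 0)]; this
    is an Euler characteristic once [cosyz C m] vanishes. *)
Definition soc_euler (C : coresolution A) m j : int :=
  \sum_(k < m) (-1) ^+ k * (soc_dim (cosyz C k) j)%:Z.

Lemma dimv_euler (C : coresolution A) m i : \dim {: cosyz C m} = 0%N ->
  (dimv_at (cosyz C 0) i)%:Z =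
    \sum_j (dimv_at (P i) j)%:Z * soc_euler C m j.
Proof.
move=> Cm.
have -> : \sum_j (dimv_at (P i) j)%:Z * soc_euler C m j =
    \sum_(k < m) (-1) ^+ k * (dimv_at (cterm C k) i)%:Z.
  rewrite /soc_euler (eq_bigr (fun j => \sum_(k < m)
    (-1) ^+ k * (dimv_at (P i) j * soc_dim (cterm C k) j)%:Z)) => [|j _].
    rewrite exchange_big; apply: eq_bigr => k _; rewrite -mulr_sumr.
    by rewrite (dim_injective_corner (cterm_inj C k)) (big_morph Posz PoszD
      (erefl _)).
  rewrite mulr_sumr; apply: eq_bigr => k _.
  by rewrite soc_dim_cterm PoszM mulrCA.
(* Additivity on the short exact sequences makes the sum telescope. *)
suff -> : \sum_(k < m) (-1) ^+ k * (dimv_at (cterm C k) i)%:Z =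
    (dimv_at (cosyz C 0) i)%:Z - (-1) ^+ m * (dimv_at (cosyz C m) i)%:Z.
  rewrite [X in _ - _ * X](_ : _ = 0) ?mulr0 ?subr0 //; congr Posz.
  by apply/eqP; rewrite -leqn0 -Cm dimvS ?subvf.
elim: m {Cm} => [|m IH]; first by rewrite big_ord0 expr0 mul1r subrr.
rewrite big_ord_recr /= {}IH dimv_at_cterm PoszD exprS; ring.
Qed.

End Cartan.

(** * Ext groups of simple modules *)

Section Connect.
Context (K : fieldType) (A : falgType K).
Implicit Types (X S : rmod A) (C : coresolution A).

Local Notation cov X := (freemod A (\dim {: rcar X})).

Definition syz_incl X : 'Hom(syzygy X, cov X) :=
  incl (lker_submod (cover_rhom (M := X))).

Lemma syz_incl_hom X : @rhom _ _ (syzygy X) (cov X) (syz_incl X).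
Proof. exact: incl_rhom. Qed.

Lemma limg_syz_incl X : limg (syz_incl X) = lker (cover X).
Proof. exact: limg_incl. Qed.

Lemma lker_syz_incl X : lker (syz_incl X) = 0%VS.
Proof. exact: lker_incl. Qed.

Lemma cover_syz_incl X : (cover X \o syz_incl X)%VF = 0.
Proof.
apply/lfunP=> x; rewrite zero_lfunE comp_lfunE; apply/eqP.
by rewrite -memv_ker -limg_syz_incl memv_img ?memvf.
Qed.

Lemma cover_syz_inclE X x : cover X (syz_incl X x) = 0.
Proof. by rewrite -comp_lfunE cover_syz_incl zero_lfunE. Qed.

Definition extends X (N : rmod A) (f : 'Hom(syzygy X, N)) : Prop :=
  exists2 g : 'Hom(cov X, N), @rhom _ _ (cov X) N g & (g \o syz_incl X)%VF = f.

Definition lifts X C (f : 'Hom(X, cosyz C 1)) : Prop :=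
  exists2 g : 'Hom(X, cterm C 0), rhom g & (cproj C 0 \o g)%VF = f.

(** [f] and [f1] are the ends of a morphism from the free presentation of [X] to the first exact
    sequence of [C]: the two descriptions of a class in [Ext^1(X, cosyz C 0)]. *)
Definition conn1 X C (f : 'Hom(syzygy X, cosyz C 0)) (f1 : 'Hom(X, cosyz C 1))
  : Prop :=
  [/\ rhom f, rhom f1 & exists2 p : 'Hom(cov X, cterm C 0), @rhom _ _ (cov X)
    (cterm C 0) p &
     (p \o syz_incl X = cemb C 0 \o f)%VF /\ (f1 \o cover X = cproj C 0 \o p)%VF].

Lemma conn1_ex X C (f : 'Hom(syzygy X, cosyz C 0)) :
  rhom f -> exists f1, @conn1 X C f f1.
Proof.
move=> hf.
have [p hp pE] := cterm_inj C 0 _ _ _ _ (@syz_incl_hom X) (lker_syz_incl X)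
  (rhom_comp hf (cemb_hom C 0)).
have [|f1 hf1 fE] := factor_epi (@cover_rhom _ _ X) (rhom_comp hp (cproj_hom C
  0)) (limg_cover X).
  rewrite -limg_syz_incl; apply/subvP=> _ /memv_imgP [x _ ->]; rewrite memv_ker.
  by rewrite comp_lfunE -[p _]comp_lfunE pE comp_lfunE cproj_cembE.
by exists f1; split=> //; exists p.
Qed.

Lemma conn1_back X C (f1 : 'Hom(X, cosyz C 1)) :
  rhom f1 -> exists f, @conn1 X C f f1.
Proof.
move=> hf1.
have [|p hp pE] := proj_lift (@freemod_projective _ A _) (cproj_hom C 0)
  (rhom_comp (@cover_rhom _ _ X) hf1).
  by rewrite limg_cproj subvf.
have [|f hf fE] := factor_mono (cemb_hom C 0) (rhom_comp (@syz_incl_hom X) hp)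
  (lker_cemb C 0).
  rewrite limg_cemb; apply/subvP=> _ /memv_imgP [x _ ->].
  by rewrite memv_ker -comp_lfunE comp_lfunA pE -comp_lfunA cover_syz_incl
    comp_lfun0r zero_lfunE.
by exists f; split=> //; exists p.
Qed.

Lemma conn1_lin X C a f f1 g g1 :
  @conn1 X C f f1 -> conn1 g g1 -> @conn1 X C (a *: f + g) (a *: f1 + g1).
Proof.
case=> hf hf1 [p hp [pE pE']] [hg hg1 [q hq [qE qE']]].
split; [exact/rhomD/hg/rhomZ | exact/rhomD/hg1/rhomZ | exists (a *: p + q)].
  exact/(rhomD (N := cterm C 0))/hq/(rhomZ (N := cterm C 0)).
by rewrite !comp_lfunDl !comp_lfunDr -!comp_lfunZl -!comp_lfunZr pE qE pE' qE'.
Qed.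

Lemma conn1_chain_step X C C' f f1 (g : 'Hom(cosyz C 0, cosyz C' 0)) g1 :
  @conn1 X C f f1 -> chain_step g g1 -> @conn1 X C' (g \o f)%VF (g1 \o f1)%VF.
Proof.
case=> hf hf1 [p hp [pE pE']] [hg hg1 [q hq [qE qE']]].
split; [exact: rhom_comp | exact: rhom_comp |exists (q \o p)%VF].
  exact: (rhom_comp (N := cterm C 0)).
split; first by rewrite -comp_lfunA pE !comp_lfunA qE.
by rewrite -comp_lfunA pE' !comp_lfunA qE'.
Qed.

(** Either condition is a null-homotopy of the morphism of exact sequences: subtracting it from [p]
    leaves a map that factors at the other end. *)
Lemma conn1_extends X C f f1 : @conn1 X C f f1 -> (extends f <-> lifts f1).
Proof.
case=> hf hf1 [p hp [pE pE']]; split=> [[g hg gE]|[g hg gE]].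
  have hig := rhom_comp hg (cemb_hom C 0).
  have [|u hu uE] := factor_epi (@cover_rhom _ _ X) (rhomB (N := cterm C 0) hp
    hig) (limg_cover X).
    rewrite -limg_syz_incl; apply/subvP=> _ /memv_imgP [x _ ->]; rewrite memv_ker.
    by rewrite sub_lfunE -!comp_lfunE pE -comp_lfunA gE subrr.
  exists u => //; apply/lfunP=> y; have [x <-] := limg_fullP y (limg_cover X).
  rewrite -!comp_lfunE -comp_lfunA uE pE' 2!comp_lfunE sub_lfunE linearB /=.
  by rewrite comp_lfunE cproj_cembE subr0.
have hgc := rhom_comp (@cover_rhom _ _ X) hg.
have [|u hu uE] := factor_mono (cemb_hom C 0) (rhomB (N := cterm C 0) hp hgc)
  (lker_cemb C 0).
  rewrite limg_cemb; apply/subvP=> _ /memv_imgP [x _ ->]; rewrite memv_ker.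
  by rewrite sub_lfunE linearB /= -!comp_lfunE comp_lfunA gE pE' subrr.
exists u => //; apply/lfunP=> x; apply/eqP; rewrite -subr_eq0; apply/eqP.
apply: (lker0_eq (lker_cemb C 0)); rewrite linearB /= -!comp_lfunE comp_lfunA
  uE -pE.
by rewrite !comp_lfunE sub_lfunE comp_lfunE cover_syz_inclE linear0 subr0 subrr.
Qed.

(** A map through the free module lifts because that module is projective; a map through [cterm C 0]
    extends because that term is injective. *)
Lemma extends_lifts X C (f : 'Hom(syzygy X, cosyz C 1)) : extends f <-> lifts f.
Proof.
split=> [[g hg gE]|[g hg gE]].
  have [|h hh hE] := proj_lift (@freemod_projective _ A _) (cproj_hom C 0) hg.
    by rewrite limg_cproj subvf.
  exists (h \o syz_incl X)%VF; first exact: rhom_comp (@syz_incl_hom X) hh.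
  by rewrite comp_lfunA hE gE.
have [h hh hE] := cterm_inj C 0 _ _ _ _ (@syz_incl_hom X) (lker_syz_incl X) hg.
exists (cproj C 0 \o h)%VF; first exact: rhom_comp hh (cproj_hom C 0).
by rewrite -comp_lfunA hE gE.
Qed.

(* [f] and [h] represent the same class of [Ext^k(S, cosyz C 0)], the former on
   a projective resolution of [S], the latter on the coresolution [C]. *)
Fixpoint conn k S C : 'Hom(syz k S, cosyz C 0) -> 'Hom(S, cosyz C k) -> Prop :=
  match k with
  | 0 => fun f h => rhom f /\ f = h
  | j.+1 => fun f h => exists2 f1, @conn1 (syz j S) C f f1 & @conn j S (tail C) f1 h
  end.

Lemma conn_ex k S C (f : 'Hom(syz k S, cosyz C 0)) :
  rhom f -> exists2 h, rhom h & conn f h.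
Proof.
elim: k C f => [|k IH] C f hf; first by exists f.
have [f1 cf1] := conn1_ex hf; case: (cf1) => _ hf1 _.
have [h hh ch] := IH (tail C) f1 hf1.
by exists h => //; exists f1.
Qed.

Lemma conn_back k S C (h : 'Hom(S, cosyz C k)) :
  rhom h -> exists2 f : 'Hom(syz k S, cosyz C 0), rhom f & conn f h.
Proof.
elim: k C h => [|k IH] C h hh; first by exists h.
have [f1 hf1 cf1] := IH (tail C) h hh.
have [f cf] := conn1_back (C := C) hf1; case: (cf) => hf _ _.
by exists f => //; exists f1.
Qed.

Lemma conn_lin k S C a f h g u :
  @conn k S C f h -> conn g u -> @conn k S C (a *: f + g) (a *: h + u).
Proof.
elim: k C f h g u => [|k IH] C f h g u /=.
  by case=> hf <- [hg <-]; split=> //; apply/rhomD/hg/rhomZ.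
case=> f1 cf1 ch [g1 cg1 cu]; exists (a *: f1 + g1); first exact: conn1_lin.
exact: IH.
Qed.

Lemma conn_chain_lift k S C C' f h (g : 'Hom(cosyz C 0, cosyz C' 0)) g1 :
  @conn k S C f h -> chain_lift g g1 -> @conn k S C' (g \o f)%VF (g1 \o h)%VF.
Proof.
elim: k C C' f h g g1 => [|k IH] C C' f h g g1 /=.
  by case=> hf <- [hg <-]; split=> //; apply: rhom_comp.
case=> f1 cf1 ch [g2 sg lg]; exists (g2 \o f1)%VF; first exact:
  conn1_chain_step cf1 sg.
exact: IH ch lg.
Qed.

(** The vanishing of the class of [f] in [Ext^k(S, N)]; degree 0 is apart because it has no
    coboundaries. *)
Definition ext_trivial k S (N : rmod A) : 'Hom(syz k S, N) -> Prop :=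
  match k with
  | 0 => fun f => f = 0
  | j.+1 => fun f => @extends (syz j S) N f
  end.

End Connect.

Section Trivial.
Context (K : fieldType) (A : falgType K) (n : nat) (e : 'I_n -> A).
Context (J : {vspace A}) (sb : split_basic e J).
Context (S : rmod A) (i : 'I_n) (x : S) (xS : simple_gen e J i x).

Lemma simple_hom0 (N : rmod A) (h : 'Hom(S, N)) : h x = 0 -> h = 0.
Proof.
case: xS => _ _ xgen hx; apply/lfunP=> y; have [c ->] := xgen y.
by rewrite linearZ /= hx scaler0 zero_lfunE.
Qed.

(* Minimality enters here: a map from a simple module to a cosyzygy that
   factors through the injective before it is zero. *)
Lemma conn_trivial k (C : coresolution A) f h :
  @conn _ _ k S C f h -> (ext_trivial f <-> h = 0).
Proof.
elim: k C f h => [|k IH] C f h /=; first by case=> _ ->.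
case=> f1 /conn1_extends -> cf1; case: k IH f f1 h cf1 => [|k] IH _ f1 h cf1.
  case: cf1 => hf1 <-; split=> [[g hg gE]|f10].
    apply: simple_hom0; rewrite -gE comp_lfunE; apply: (cproj_socle sb (j := i)).
    by apply: socle_img => //; case: xS.
  exists 0; first exact: rhom0.
  by rewrite f10 comp_lfun0r.
by rewrite -(IH _ _ _ cf1); apply: iff_sym; apply: extends_lifts.
Qed.

End Trivial.

Section SubquotClass.
Context (K : fieldType) (A : falgType K).

Section Subquot.
Context (M : rmod A) (Z B : {vspace M}) (hZ : is_submod Z) (hB : is_submod B).

Definition subquot_cls (x : M) : subquot hZ hB :=
  quot_proj _ (vsproj Z x : submod hZ).

Lemma subquot_cls_onto (y : subquot hZ hB) : exists2 x, x \in Z & subquot_cls x = y.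
Proof.
exists (vsval (vsval y : submod hZ)); first exact: subvsP.
by rewrite /subquot_cls vsvalK quot_projK.
Qed.

Lemma subquot_cls0 x : x \in Z -> (subquot_cls x == 0) = (x \in B).
Proof.
move=> Zx; rewrite quot_proj0 -memv_preim.
by rewrite lfunE /= vsprojK.
Qed.

Lemma subquot_cls_lin c x y :
  subquot_cls (c *: x + y) = c *: subquot_cls x + subquot_cls y.
Proof. by rewrite /subquot_cls !linearP. Qed.

Lemma subquot_cls_act a x : x \in Z ->
  subquot_cls (ract M a x) = ract (subquot hZ hB) a (subquot_cls x).
Proof.
move=> Zx; rewrite /subquot_cls.
have -> : vsproj Z (ract M a x) = ract (submod hZ) a (vsproj Z x : submod hZ).
  by apply: subvs_inj; rewrite [in RHS](sub_actE hZ) !vsprojK //; apply: hZ.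
exact: (@quot_proj_rhom _ _ _ _ (@subquot_fact _ _ M Z B hZ hB) a (vsproj Z x :
  submod hZ)).
Qed.

End Subquot.
End SubquotClass.

Section ExtClass.
Context (K : fieldType) (A : falgType K).

Section Class.
Context (k : nat) (S : rmod A).
Local Notation reg := (regmod A).

(** Cocycles kill the kernel of the cover, so they are the maps out of the [k]-th syzygy; classes
    are parametrised by these. *)
Definition ext_cls (g : 'Hom(syz k S, reg)) : Ext k S :=
  @subquot_cls K A^c _ _ _ (@cocycles_submod _ _ _ (std_diff S) k)
    (@coboundaries_submod _ _ _ (std_diff S) k)
    ((g \o cover (syz k S))%VF : 'Hom(std_term S k, A)).

Lemma cocycle_cover (g : 'Hom(syz k S, reg)) : rhom g ->
  ((g \o cover (syz k S))%VF : 'Hom(std_term S k, A)) \in cocycles (std_diff S) k.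
Proof.
move=> hg; apply/mem_cocycles; split.
  exact: (rhom_comp (@cover_rhom _ _ (syz k S)) hg).
apply/lfunP=> x; rewrite zero_lfunE -comp_lfunA comp_lfunE.
rewrite [(_ \o _)%VF x](_ : _ = 0) ?linear0 // comp_lfunE; apply/eqP.
by rewrite -memv_ker -limg_std_diff memv_img ?memvf.
Qed.

Lemma ext_cls_onto (y : Ext k S) : exists2 g, rhom g & ext_cls g = y.
Proof.
have [f Zf <-] := subquot_cls_onto y.
have [hf fd] := (mem_cocycles _ _).1 Zf.
have [|g hg gE] := @factor_epi _ _ (std_term S k) (syz k S) reg _ f
  (@cover_rhom _ _ (syz k S)) hf (limg_cover _).
  rewrite -limg_std_diff; apply/subvP=> _ /memv_imgP [x _ ->].
  by rewrite memv_ker -comp_lfunE fd zero_lfunE.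
by exists g => //; rewrite /ext_cls gE.
Qed.

Lemma ext_cls_lin c g g' : ext_cls (c *: g + g') = c *: ext_cls g + ext_cls g'.
Proof. by rewrite /ext_cls comp_lfunDl -comp_lfunZl subquot_cls_lin. Qed.

Lemma ext_cls_act (a : A) (g : 'Hom(syz k S, reg)) : rhom g ->
  ext_cls ((amull a : 'Hom(reg, reg)) \o g)%VF = ract (Ext k S) (a : A^c)
    (ext_cls g).
Proof.
move=> hg; rewrite -subquot_cls_act ?cocycle_cover //.
congr (subquot_cls _ _ _); rewrite -comp_lfunA; apply: esym; exact: hom_actE.
Qed.

End Class.

Lemma ext_cls0 k S (g : 'Hom(syz k S, regmod A)) : rhom g ->
  ext_cls g = 0 <-> ext_trivial g.
Proof.
move=> hg; apply: (iff_trans (B := is_true (ext_cls g == 0))).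
  by split=> [/eqP|/eqP].
rewrite subquot_cls0 ?cocycle_cover //.
case: k g hg => [|k] g hg.
  rewrite memv0; split=> [/eqP g0|->]; last by rewrite comp_lfun0l.
  apply/lfunP=> y; have [x <-] := limg_fullP y (limg_cover _).
  by rewrite -comp_lfunE g0 !zero_lfunE.
split=> [/mem_coboundaries [h hh hE]|[h hh hE]]; last first.
  by apply/mem_coboundaries; exists h => //; rewrite -hE comp_lfunA.
exists h => //; apply/lfunP=> y; have [x <-] := limg_fullP y (limg_cover _).
by rewrite -[g _]comp_lfunE hE comp_lfunE [RHS]comp_lfunE comp_lfunE.
Qed.

End ExtClass.

(** * The grade bijection *)

Section GradeBijection.
Context (K : fieldType) (A : falgType K) (n : nat) (e : 'I_n -> A).
Context (J : {vspace A}) (sb : split_basic e J).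
Local Notation P t := (idealmod (e t)).
Context (cA : coresolution A) (D : nat).
Hypothesis cA_summand : forall t, exists (i : 'Hom(P t, cosyz cA 0)) (p :
  'Hom(cosyz cA 0, P t)),
  [/\ rhom i, rhom p & (p \o i)%VF = \1%VF].
Hypothesis cA_vanish : forall k, ext_vanish (cterm cA k) k.
Hypothesis gldim : forall X : rmod A, ext_vanish X D.

Definition cP t : coresolution A := min_coresolution (P t).

(** The inclusion of [P t] into [A] lifts to a monomorphism of [k]-th cosyzygies, since it can be
    tested on socles. It extends to the envelopes, so the term for [P t] is a summand of the term
    for [A]. *)
Lemma cP_vanish t k : ext_vanish (cterm (cP t) k) k.
Proof.
have [i [p [hi hp pi]]] := cA_summand t.
have [ik lik] := chain_lift_ex k (hi : @rhom _ _ (cosyz (cP t) 0) (cosyz cA 0) i).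
have [pk lpk] := chain_lift_ex k (hp : @rhom _ _ (cosyz cA 0) (cosyz (cP t) 0) p).
(* A lift of [1 - p \o i], which is zero, so [pk \o ik] is the identity on socles. *)
have l0 := chain_lift_lin (-1) (chain_lift_comp lik lpk) (chain_lift_id k (cP t)).
rewrite [X in chain_lift X](_ : _ = 0) in l0; last first.
  by rewrite pi scaleN1r addNr.
have [_ hik] := chain_lift_hom lik; have [_ hpk] := chain_lift_hom lpk.
have ik0 : lker ik = 0%VS.
  apply: (lker0_socle sb hik) => j x xs ikx.
  have := chain_lift0_socle sb l0 xs.
  by rewrite add_lfunE scale_lfunE id_lfunE comp_lfunE ikx linear0 scaler0 add0r.
have [q hq qE] := cterm_inj cA k _ _ _ _ (cemb_hom (cP t) k) (lker_cemb (cP t) k)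
  (rhom_comp hik (cemb_hom cA k)).
have q0 : lker q = 0%VS.
  apply: (essential_lker (cemb_essential (cP t) k) hq); rewrite qE.
  apply: lker0_cond => x; rewrite comp_lfunE => /(lker0_eq (lker_cemb cA k)).
  exact: lker0_eq.
have [r hr rE] := cterm_inj (cP t) k _ _ _ _ hq q0 (@rhom_id _ _ _).
exact: (ext_vanish_retract hq hr rE (@cA_vanish k)).
Qed.

Lemma ideal_lift_back u t k (h : 'Hom(cosyz (cP u) k, cosyz (cP t) k)) :
  rhom h -> exists f : 'Hom(P u, P t), chain_lift (C := cP u) (C' := cP t) f h.
Proof.
move=> hh; apply: (@chain_lift_back _ _ k (cP u) (cP t) h) => // j g _.
exact: cP_vanish.
Qed.

Lemma cosyz_gldim0 (C : coresolution A) : \dim {: cosyz C D.+1} = 0%N.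
Proof. exact/ext_vanish_dim0/gldim. Qed.

Lemma idim_ex t : exists k, \dim {: cosyz (cP t) k.+1} == 0%N.
Proof. by exists D; rewrite cosyz_gldim0. Qed.

(* By minimality this is the injective dimension of [P t]. *)
Definition idim t : nat := ex_minn (idim_ex t).

Lemma idim_dim0 t : \dim {: cosyz (cP t) (idim t).+1} = 0%N.
Proof. by rewrite /idim; case: ex_minnP => m /eqP. Qed.

Lemma idim_neq0 t : \dim {: cosyz (cP t) (idim t)} <> 0%N.
Proof.
rewrite /idim; case: ex_minnP => -[|m] _ minm; last first.
  by move=> m0; have := minm m; rewrite m0 eqxx ltnn => /(_ isT).
by move/(dim0_eq0 (ideal_gen e t)) => /eqP; apply/negP/(ideal_gen_neq0 sb).
Qed.

Lemma idim_injective t : injective_mod (cosyz (cP t) (idim t)).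
Proof. exact/cosyz_injective/idim_dim0. Qed.

(* Otherwise the projection of the socle onto [K x] killing [y] extends to an
   endomorphism, which lifts to [P t], hence is a scalar plus a nilpotent. *)
Lemma idim_socle_line t i j x y : x \in socle e J (cosyz (cP t) (idim t)) i ->
  y \in socle e J (cosyz (cP t) (idim t)) j -> x != 0 -> y \in <[x]>%VS.
Proof.
move=> xs ys x0; apply: contraT => xy.
have y0 : y != 0 by apply: contraNneq xy => ->; rewrite mem0v.
pose hy := socle_line sb ys; pose q := quot_proj <[y]>%VS.
have hq : @rhom _ _ _ (quotmod hy) q by exact: quot_proj_rhom.
have qx0 : q x != 0.
  rewrite quot_proj0; apply: contraNN xy => /vlineP [c xc].
  have c0 : c != 0 by apply: contraNneq x0 => c0; rewrite xc c0 scale0r.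
  by rewrite -(scalerK c0 y) -xc memvZ ?memv_line.
have qy0 : q y = 0 by apply/eqP; rewrite quot_proj0 memv_line.
have [g hg gE] := socle_extend sb (@idim_injective t) (socle_img hq xs) qx0 xs.
have [f lf] := ideal_lift_back (rhom_comp hq hg).
have [hf _] := chain_lift_hom lf; have [c [m fm]] := ideal_endo_split sb hf.
(* A power of [f - c] is zero, while the lift [g \o q - c] has eigenvalue [1 - c] on [x] and [- c]
   on [y]; both would have to vanish. *)
have := chain_lift_lin (- c) (chain_lift_id (idim t) (cP t)) lf.
rewrite !scaleNr [- _ + f]addrC => lg.
have := chain_lift_lpow m lg; rewrite [X in chain_lift X]fm => {}lg.
have := chain_lift0_socle sb lg xs; rewrite (@lpow_eigen _ _ _ m (1 - c)); last
  first.
  by rewrite add_lfunE opp_lfunE scale_lfunE id_lfunE comp_lfunE gE scalerBl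
    scale1r addrC.
move/eqP; rewrite scaler_eq0 (negPf x0) orbF expf_eq0 subr_eq0 => /andP [_ /eqP c1].
have := chain_lift0_socle sb lg ys; rewrite (@lpow_eigen _ _ _ m (- c)); last first.
  by rewrite add_lfunE opp_lfunE scale_lfunE id_lfunE comp_lfunE qy0 linear0
    addr0 scaleNr.
by move/eqP; rewrite scaler_eq0 (negPf y0) orbF expf_eq0 oppr_eq0 -c1 oner_eq0
  andbF.
Qed.

Lemma idim_socle_ex t : exists i, exists2 x,
  x \in socle e J (cosyz (cP t) (idim t)) i & x != 0.
Proof.
have [|W0|i [x xs [_ x0]]] := @socle_neq0 _ _ _ _ _ sb (cosyz (cP t) (idim t))
  fullv.
- by move=> a x _; exact: memvf.
- by apply: (@idim_neq0 t); rewrite W0 dimv0.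
- by exists i, x.
Qed.

(** The choice is harmless, because [idim_socle_line] makes the whole socle one line. *)
Definition psi t : 'I_n := projT1 (cid (idim_socle_ex t)).

Lemma psi_socle t : exists2 x,
  x \in socle e J (cosyz (cP t) (idim t)) (psi t) & x != 0.
Proof. exact: projT2 (cid (idim_socle_ex t)). Qed.

(* The last term for [t] is the injective envelope of [y], hence a summand of
   the [k]-th term for [u]. *)
Lemma idim_le_socle t u k y :
  y \in socle e J (cosyz (cP u) k) (psi t) -> y != 0 -> (idim t <= k)%N.
Proof.
move=> ys y0; rewrite leqNgt; apply/negP=> kt.
have [x xs x0] := psi_socle t.
have [h hh hx] := socle_extend sb (cterm_inj (cP u) k) xs x0 (socle_img
  (cemb_hom _ _) ys).
have h0 : lker h = 0%VS.
  apply: (lker0_socle sb hh) => j z zs; have /vlineP [c ->] := idim_socle_line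
    xs zs x0.
  rewrite linearZ /= hx => cy.
  have /(lker0_eq (lker_cemb (cP u) k))/eqP : cemb (cP u) k (c *: y) = 0.
    by rewrite linearZ.
  by rewrite scaler_eq0 (negPf y0) orbF => /eqP ->; rewrite scale0r.
have [r hr rE] := @idim_injective t _ _ _ _ hh h0 (@rhom_id _ _ _).
have := ext_vanish_retract hh hr rE (@cP_vanish u k).
case: (idim t) (@idim_neq0 t) kt => [//|l] ldim; rewrite ltnS => kl.
by move/(ext_vanish_le kl)/ext_vanish_dim0.
Qed.

Lemma psi_inj : injective psi.
Proof.
move=> t u tu; apply/eqP; apply: contraT => ntu.
have [x xs x0] := psi_socle t; have [y ys y0] := psi_socle u.
(* Equal degrees are needed for maps between the two last cosyzygies to lift back to [P t] and
   [P u]. *)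
have lE : idim t = idim u.
  apply/eqP; rewrite eqn_leq; apply/andP; split.
    by apply: (@idim_le_socle t u (idim u) y) => //; rewrite tu.
  by apply: (@idim_le_socle u t (idim t) x) => //; rewrite -tu.
have injt := @idim_injective t; have inju := @idim_injective u.
rewrite -lE -tu in y ys y0 inju.
have [h hh hx] := socle_extend sb inju xs x0 ys.
have [g hg gy] := socle_extend sb injt ys y0 xs.
have [f lf] := ideal_lift_back hh; have [f' lf'] := ideal_lift_back hg.
have [hf _] := chain_lift_hom lf; have [hf' _] := chain_lift_hom lf'.
(* The composite on [P t] is nilpotent, while its lift fixes [x]. *)
have [m fm] := ideal_comp_nilp sb hf hf' ntu.
have := chain_lift_lpow m (chain_lift_comp lf lf'); rewrite [X in chain_lift
  X]fm => lg.
have := chain_lift0_socle sb lg xs; rewrite (@lpow_eigen _ _ _ m 1).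
  by rewrite expr1n scale1r => x00; rewrite x00 eqxx in x0.
by rewrite comp_lfunE hx gy scale1r.
Qed.

Local Notation reg := (regmod A).

Definition ideal_incl u : 'Hom(P u, reg) := incl (@limg_amull_submod _ _ (e u)).
Definition ideal_proj u : 'Hom(reg, P u) :=
  (linfun (vsproj (limg (amull (e u)))) \o amull (e u))%VF.

Lemma ideal_inclE u y : ideal_incl u y = ideal_val y.
Proof. exact: inclE. Qed.

Lemma ideal_projE u a : ideal_val (ideal_proj u a) = e u * a.
Proof.
rewrite /ideal_val /ideal_proj comp_lfunE lfunE /= vsprojK ?lfunE //.
by apply/memv_imgP; exists a; rewrite ?memvf // lfunE.
Qed.

Lemma ideal_incl_hom u : rhom (ideal_incl u).
Proof. exact: incl_rhom. Qed.

Lemma ideal_proj_hom u : @rhom _ _ reg (P u) (ideal_proj u).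
Proof.
move=> a b; apply: ideal_val_inj; rewrite ideal_actE !ideal_projE.
by rewrite lfunE /= mulrA.
Qed.

Lemma ideal_projK u : (ideal_proj u \o ideal_incl u)%VF = \1%VF.
Proof.
apply/lfunP=> y; apply: ideal_val_inj; rewrite comp_lfunE id_lfunE ideal_projE.
by rewrite ideal_inclE; have [b ->] := ideal_valP y; rewrite mulrA (e_id sb).
Qed.

Lemma ideal_inclK u : (ideal_incl u \o ideal_proj u)%VF = amull (e u).
Proof. by apply/lfunP=> a; rewrite comp_lfunE ideal_inclE ideal_projE lfunE. Qed.

Lemma ext_trivial_comp k S (N N' : rmod A) (f : 'Hom(syz k S, N)) (q : 'Hom(N,
  N')) :
  rhom q -> ext_trivial f -> ext_trivial (q \o f)%VF.
Proof.
move=> hq; case: k f => [|k] f /=; first by move=> ->; rewrite comp_lfun0r.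
case=> g hg gE; exists (q \o g)%VF; first exact: rhom_comp hg hq.
by rewrite -comp_lfunA gE.
Qed.

Section SimpleExt.
Context (S : rmod A) (i : 'I_n) (x : S) (xS : simple_gen e J i x).
Implicit Types k : nat.

Lemma ext_cls_incl0 k u (f : 'Hom(syz k S, P u)) : rhom f ->
  ext_cls (ideal_incl u \o f)%VF = 0 <-> ext_trivial f.
Proof.
move=> hf; rewrite ext_cls0; last exact: rhom_comp hf (@ideal_incl_hom u).
split=> [tf|]; last exact/ext_trivial_comp/ideal_incl_hom.
have := ext_trivial_comp (@ideal_proj_hom u) tf.
by rewrite comp_lfunA ideal_projK comp_lfun1l.
Qed.

(** The idempotent [e u] acts on coefficients as the projection of [A] onto its summand [P u]. *)
Lemma ext_cls_e k u (g : 'Hom(syz k S, reg)) : rhom g ->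
  ract (Ext k S) (e u : A^c) (ext_cls g) =
  ext_cls (ideal_incl u \o (ideal_proj u \o g))%VF.
Proof. by move=> hg; rewrite comp_lfunA ideal_inclK ext_cls_act. Qed.

(** A nonzero class has a nonzero component in some [Ext^k(S, P u)], which is seen as a socle vector
    of the [k]-th cosyzygy of [P u]. *)
Lemma ext_component k (g : 'Hom(syz k S, reg)) : rhom g -> ext_cls g != 0 ->
  exists u, exists2 h : 'Hom(S, cosyz (cP u) k), rhom h /\ h x != 0 &
    conn (C := cP u) (ideal_proj u \o g)%VF h.
Proof.
move=> hg g0.
have [u gu] : exists u, ract (Ext k S) (e u : A^c) (ext_cls g) != 0.
  apply/existsP; apply: contraNT g0; rewrite negb_exists => /forallP eg.
  rewrite -[ext_cls g](@ract1E _ A^c) -[1](sb_sum sb) (@ract_sum _ A^c).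
  by rewrite big1 // => u _; apply/eqP; rewrite -[_ == _]negbK.
have hu : @rhom _ _ _ (P u) (ideal_proj u \o g)%VF := rhom_comp hg
  (@ideal_proj_hom u).
have [h hh ch] := @conn_ex _ _ k S (cP u) _ hu.
exists u, h => //; split=> //; apply: contraNneq gu => hx.
rewrite ext_cls_e //; apply/eqP/ext_cls_incl0 => //.
exact/(conn_trivial sb xS ch)/(simple_hom0 xS).
Qed.

Lemma ext_nontrivial k u (f : 'Hom(syz k S, P u)) (h : 'Hom(S, cosyz (cP u) k)) :
  rhom f -> conn (C := cP u) f h -> h x != 0 ->
  ext_cls (ideal_incl u \o f)%VF != 0.
Proof.
move=> hf ch; apply: contraNneq => /(ext_cls_incl0 hf)/(conn_trivial sb xS ch) ->.
by rewrite zero_lfunE.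
Qed.

End SimpleExt.

Section LastExt.
Context (t : 'I_n) (S : rmod A) (x : S) (xS : simple_gen e J (psi t) x).
Local Notation g := (idim t).
Local Notation E := (Ext g S).

Lemma grade_simple : grade S = Some g.
Proof.
have dimP k : \dim {: Ext k S} != 0%N -> (g <= k)%N.
  rewrite dimv_eq0 => /eqP E0.
  have [y y0] : exists y : Ext k S, y != 0.
    apply: contrapT => no; apply: E0; apply/eqP; rewrite -subv0; apply/subvP=> y _.
    by rewrite memv0; apply: contra_notT no => y0; exists y.
  have [f hf fy] := ext_cls_onto y; rewrite -fy in y0.
  have [u [h [hh hx] _]] := ext_component xS hf y0.
  apply: (idim_le_socle _ hx); apply: socle_img => //; by case: xS.
have dim_g : \dim {: E} != 0%N.
  have [z zs z0] := psi_socle t; have [h hh hx] := simple_hom sb xS zs.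
  have [f hf cf] := @conn_back _ _ g S (cP t) h hh.
  have := @ext_nontrivial S _ x xS g t f h hf cf; rewrite hx => /(_ z0).
  by apply: contraNneq => E0; rewrite (dim0_eq0 (ext_cls _) E0).
rewrite /grade; case: pselect => [exE|[]]; last by exists g.
case: ex_minnP => m /dimP gm minm; congr Some; apply/eqP.
by rewrite eqn_leq gm minm.
Qed.

(** In the form needed for the dual: [e_t E] is the line of [y0], and every nonzero submodule meets
    it. So [y0] spans the socle of this left module. *)
Lemma ext_socle : exists2 y0 : E, y0 != 0 /\ ract E (e t : A^c) y0 = y0 &
  (forall y : E, ract E (e t : A^c) y = y -> exists c, y = c *: y0) /\
  (forall y : E, y != 0 -> exists2 a : A, e t * a = a & ract E (a : A^c) y != 0).
Proof.
have [z zs z0] := psi_socle t; have [h0 hh0 h0x] := simple_hom sb xS zs.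
have [f0 hf0 cf0] := @conn_back _ _ g S (cP t) h0 hh0.
pose y0 : E := ext_cls (ideal_incl t \o f0)%VF.
have hif0 : @rhom _ _ _ reg (ideal_incl t \o f0)%VF := rhom_comp hf0
  (@ideal_incl_hom t).
exists y0; first split.
- by apply: (ext_nontrivial xS hf0 cf0); rewrite h0x.
- by rewrite ext_cls_e // [(ideal_proj t \o _)%VF]comp_lfunA ideal_projK
  comp_lfun1l.
split=> [y|y y_neq0].
  have [f hf <-] := ext_cls_onto y; rewrite ext_cls_e // => fE.
  have hpf : @rhom _ _ _ (P t) (ideal_proj t \o f)%VF := rhom_comp hf
    (@ideal_proj_hom t).
  have [h hh ch] := @conn_ex _ _ g S (cP t) _ hpf.
  have hxs : h x \in socle e J (cosyz (cP t) g) (psi t).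
    by apply: socle_img => //; case: xS.
  have /vlineP [c hx] := idim_socle_line zs hxs z0.
  exists c; apply/eqP; rewrite -subr_eq0 -fE addrC -scaleNr; apply/eqP.
  rewrite /y0 -ext_cls_lin comp_lfunZr -comp_lfunDr.
  have hu : @rhom _ _ _ (P t) (- c *: f0 + (ideal_proj t \o f)%VF).
    by apply: rhomD => //; apply: rhomZ.
  apply/ext_cls_incl0 => //.
  apply/(conn_trivial sb xS (conn_lin (- c) cf0 ch)); apply: (simple_hom0 xS).
  by rewrite add_lfunE scale_lfunE h0x hx scaleNr addNr.
have [f hf fy] := ext_cls_onto y; rewrite -fy in y_neq0 *.
have [u [h [hh hx] ch]] := ext_component xS hf y_neq0.
have hxs : h x \in socle e J (cosyz (cP u) g) (psi t).
  by apply: socle_img => //; case: xS.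
(* A map of cosyzygies taking [h x] to [z] lifts back to left multiplication by some [a] in
   [e_t A e_u], which therefore keeps the class nonzero. *)
have [th hth thx] := socle_extend sb (@idim_injective t) hxs hx zs.
have [b lb] := ideal_lift_back hth; have [hb _] := chain_lift_hom lb.
have [a aE bE] := ideal_hom sb hb.
have ea : e t * a = a by rewrite aE !mulrA (e_id sb).
have ae : a * e u = a by rewrite aE -!mulrA (e_id sb).
exists a; first exact: ea.
rewrite -(ext_cls_act a hf).
have -> : ((amull a : 'Hom(reg, reg)) \o f)%VF =
    (ideal_incl t \o (b \o (ideal_proj u \o f)))%VF.
  apply/lfunP=> v; rewrite comp_lfunE lfunE comp_lfunE ideal_inclE comp_lfunE bE.
  by rewrite comp_lfunE ideal_projE mulrA ae.
apply: (ext_nontrivial xS _ (conn_chain_lift ch lb)).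
  exact: rhom_comp (rhom_comp hf (@ideal_proj_hom u)) hb.
by rewrite comp_lfunE thx.
Qed.

End LastExt.

End GradeBijection.

(** * Duality and the top of a dual module *)

Section Duality.
Context (K : fieldType).

Lemma functional_neq0 (V : vectType K) (y : V) : y != 0 ->
  exists f : 'Hom(V, K^o), f y != 0.
Proof.
move=> y0.
have [i yi] : exists i, coord (vbasis fullv) i y != 0.
  apply/existsP; apply: contraNT y0; rewrite negb_exists => /forallP yi.
  rewrite (coord_vbasis (memvf y)) big1 // => i _.
  by have := yi i; rewrite negbK => /eqP ->; rewrite scale0r.
by exists (linfun (coord (vbasis fullv) i : V -> K^o)); rewrite lfunE.
Qed.

(** Reflexivity of [V]; [v] has the coordinates [l (c i)]. *)
Lemma functional_eval (V : vectType K) (l : 'Hom('Hom(V, K^o), K^o)) :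
  exists v, forall f, l f = f v.
Proof.
pose b := vbasis {: V}; pose c i : 'Hom(V, K^o) := linfun (coord b i : V -> K^o).
exists (\sum_(i < \dim {: V}) (l (c i) : K) *: b`_i) => f.
have {1}-> : f = \sum_(i < \dim {: V}) (f b`_i : K) *: c i.
  apply/lfunP=> v; rewrite sum_lfunE {1}(coord_vbasis (memvf v)) linear_sum.
  apply: eq_bigr => i _; rewrite linearZ /= scale_lfunE lfunE /=.
  exact: mulrC.
rewrite !linear_sum; apply: eq_bigr => i _; rewrite !linearZ /=.
exact: mulrC.
Qed.

End Duality.

Section DualTop.
Context (K : fieldType) (A : falgType K) (n : nat) (e : 'I_n -> A).
Context (J : {vspace A}) (sb : split_basic e J) (t : 'I_n).
Context (E : rmod A^c) (y0 : E).
Hypotheses (y0_neq0 : y0 != 0) (y0_e : ract E (e t : A^c) y0 = y0).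
Hypothesis y0_line : forall y : E, ract E (e t : A^c) y = y -> exists c, y = c
  *: y0.
Hypothesis ess_y0 : forall y : E, y != 0 ->
  exists2 a : A, e t * a = a & ract E (a : A^c) y != 0.

(** A functional [xi = xi e_t] that is nonzero on [y0] generates the dual, so the top of a cyclic
    module applies. *)
Lemma dual_top : exists z : top (dual E), simple_gen e J t z.
Proof.
have [f0 f0y] := functional_neq0 y0_neq0.
pose xi : dual E := (f0 \o ract E (e t : A^c))%VF.
have xiy : (xi : 'Hom(E, K^o)) y0 != 0 by rewrite comp_lfunE y0_e.
apply: (@cyclic_top _ _ _ _ _ sb (dual E) xi t).
- rewrite /= dual_actE /xi -comp_lfunA; congr (_ \o _)%VF.
  rewrite -(@ractM K A^c); congr (ract E _); exact: (e_id sb).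
- by apply: contraNneq xiy => ->; rewrite zero_lfunE.
move=> eta.
have phi_lin1 y : linear (fun a : A => (xi : 'Hom(E, K^o)) (ract E (a : A^c) y)).
  by move=> k a b; rewrite (@ractD _ A^c) (@ractZ _ A^c) linearP.
pose phi1 y : {linear A -> K^o} :=
  HB.pack (fun a : A => (xi : 'Hom(E, K^o)) (ract E (a : A^c) y))
    (GRing.isLinear.Build K _ _ _ _ (phi_lin1 y)).
pose phi0 (y : E) : 'Hom(A, K^o) := linfun (phi1 y).
have phi0E y a : phi0 y a = (xi : 'Hom(E, K^o)) (ract E (a : A^c) y) by rewrite
  lfunE.
have phi_lin : linear phi0.
  move=> k y z; apply/lfunP=> a; rewrite add_lfunE scale_lfunE !phi0E.
  by rewrite !linearP.
(* [phi] embeds [E] in [Hom_K(A, K)]. A functional [eta] on [E] extends along it and becomes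
   evaluation at some [a], which means [eta = xi a]. *)
pose phi : 'Hom(E, 'Hom(A, K^o)) := linfun (HB.pack_for {linear E -> 'Hom(A, K^o)}
  phi0 (GRing.isLinear.Build K _ _ _ phi0 phi_lin)).
have phiE y a : (phi y) a = (xi : 'Hom(E, K^o)) (ract E (a : A^c) y).
  by rewrite lfunE /= phi0E.
have phi_inj : lker phi = 0%VS.
  apply: lker0_cond => y phiy; apply: contrapT => /eqP /ess_y0 [a ea ay].
  have [|c ac] := @y0_line (ract E (a : A^c) y).
    by rewrite (@ractA _ A^c); congr (ract E _ y).
  have := phiE y a; rewrite phiy zero_lfunE ac linearZ /= => /esym/eqP.
  rewrite mulf_eq0 (negPf xiy) orbF => /eqP c0.
  by move: ay; rewrite ac c0 scale0r eqxx.
have [a aE] := functional_eval (eta \o phi^-1)%VF.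
exists a; apply/lfunP=> y; rewrite /= dual_actE comp_lfunE -phiE -aE comp_lfunE.
by rewrite lker0_lfunK // phi_inj.
Qed.

End DualTop.

(** * The Coxeter matrix *)

Section Assembly.
Context (K : fieldType) (A : falgType K) (n : nat) (e : 'I_n -> A).
Context (J : {vspace A}) (sb : split_basic e J).
Local Notation P t := (idealmod (e t)).

Lemma dimv_ideal i j :
  dimv_at e (P j) i = \dim (limg (amull (e j) \o amulr (e i))).
Proof.
rewrite /dimv_at -(@limg_dim_eq _ _ _ (ideal_incl e j) (limg _)); last first.
  by rewrite lker_incl capv0.
congr (\dim _); apply/vspaceP=> a; apply/memv_imgP/memv_imgP => -[y].
  case/memv_imgP=> b _ -> ->; exists (ideal_val b); first exact: memvf.
  rewrite ideal_inclE ideal_actE comp_lfunE !lfunE /=.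
  by have [c ->] := ideal_valP b; rewrite !mulrA (e_id sb).
move=> _ ->; exists (ract (P j) (e i) (ideal_proj e j y)).
  exact: memv_img (memvf _).
by rewrite ideal_inclE ideal_actE ideal_projE comp_lfunE !lfunE /= mulrA.
Qed.

Lemma dimv_simple (S : rmod A) i (x : S) l :
  simple_gen e J i x -> dimv_at e S l = (l == i).
Proof.
case=> /socleP [xe _] x0 xgen; rewrite /dimv_at.
have -> : limg (ract S (e l)) = <[ract S (e l) x]>%VS.
  rewrite -limg_line; congr (_ @: _)%VS; apply/vspaceP=> y; rewrite memvf.
  by have [c ->] := xgen y; rewrite memvZ ?memv_line.
rewrite dim_vline; have [->|li] := eqVneq l i; first by rewrite xe x0.
by rewrite (e_fix_orth sb xe li) eqxx.
Qed.

Definition cart : 'M[int]_n := \matrix_(i, j) (dimv_at e (P j) i)%:Z.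

Section Invert.
Context (D : nat).
Hypothesis gldim : forall X : rmod A, ext_vanish X D.

Definition euler_mx (C : 'I_n -> coresolution A) : 'M[int]_n :=
  \matrix_(j, i) soc_euler e J (C i) D.+1 j.

Lemma cart_euler (C : 'I_n -> coresolution A) :
  cart^T *m euler_mx C = \matrix_(i, j) (dimv_at e (cosyz (C j) 0) i)%:Z.
Proof.
apply/matrixP=> i t; rewrite !mxE (@dimv_euler _ _ _ _ _ sb (C t) D.+1 i).
  by apply: eq_bigr => j _; rewrite !mxE.
exact: cosyz_gldim0.
Qed.

(** The coresolutions of the simple modules supply the integral inverse, as the dimension vectors of
    simple modules form the identity matrix. *)
Lemma cart_unit : cart \in unitmx.
Proof.
have [X /mulmx1_unit [+ _]] : exists X, cart^T *m X = 1%:M.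
  exists (euler_mx (fun i => min_coresolution (top (P i)))); rewrite cart_euler.
  apply/matrixP=> l i; rewrite !mxE.
  by have [x xS] := ideal_top sb i; rewrite (dimv_simple l xS); case: eqP.
by rewrite unitmx_tr.
Qed.

(** For the modules [P t] the matrix of dimension vectors is [cart] itself, so the Euler matrix is
    the inverse of [cart^T] times [cart]. *)
Lemma coxeter_euler :
  - (cart^T *m invmx cart) = - (euler_mx (cP e))^T.
Proof.
congr (- _); apply: trmx_inj; rewrite trmxK trmx_mul trmxK trmx_inv.
have -> : euler_mx (cP e) = invmx cart^T *m (cart^T *m euler_mx (cP e)).
  by rewrite mulKmx // unitmx_tr cart_unit.
congr (_ *m _); rewrite cart_euler; apply/matrixP=> i j; by rewrite !mxE.
Qed.

End Invert.

Section Triangular.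
Context (cA : coresolution A) (D : nat).
Hypothesis cA_summand : forall t, exists (i : 'Hom(P t, cosyz cA 0)) (p :
  'Hom(cosyz cA 0, P t)),
  [/\ rhom i, rhom p & (p \o i)%VF = \1%VF].
Hypothesis cA_vanish : forall k, ext_vanish (cterm cA k) k.
Hypothesis gldim : forall X : rmod A, ext_vanish X D.
Local Notation psi := (psi sb gldim).
Local Notation idim := (idim e gldim).

(** With [j = psi t], a socle vector of type [j] in degree [k] gives
    [idim u <= idim t <= k <= idim u]. The hypothesis on [t] is what an admissible ordering
    provides. *)
Lemma socle_psi_last u j k : soc_dim e J (cosyz (cP e u) k) j != 0%N ->
  (forall t, psi t = j -> idim u <= idim t)%N -> k = idim u /\ j = psi u.
Proof.
rewrite /soc_dim dimv_eq0 => s0 le_u.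
have [y ys y0] : exists2 y, y \in socle e J (cosyz (cP e u) k) j & y != 0.
  apply: contrapT => no; case/eqP: s0; apply/eqP; rewrite -subv0.
  apply/subvP=> y ys; rewrite memv0; apply: contra_notT no => y0; by exists y.
have ku : (k <= idim u)%N.
  rewrite leqNgt; apply: contra_neqN y0 => uk.
  exact/(dim0_eq0 y)/(cosyz_dim0_le uk)/idim_dim0.
have [psiV _ psiVK] := injF_bij (@psi_inj _ _ _ _ _ sb cA D cA_summand
  cA_vanish gldim).
have jE : psi (psiV j) = j by exact: psiVK.
have uk : (idim u <= k)%N.
  apply: leq_trans (le_u _ jE) _.
  have := @idim_le_socle _ _ _ _ _ sb cA D cA_summand cA_vanish gldim (psiV j)
    u k y.
  by rewrite jE; apply.
have kE : k = idim u by apply/eqP; rewrite eqn_leq ku uk.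
split=> //; rewrite kE in y ys y0 *.
have [z zs z0] := psi_socle sb gldim u.
have /vlineP [c yc] := idim_socle_line sb cA_summand cA_vanish zs ys z0.
by apply: (socle_index sb ys _ y0); rewrite yc memvZ.
Qed.

Lemma soc_dim_last u : soc_dim e J (cosyz (cP e u) (idim u)) (psi u) = 1%N.
Proof.
have [z zs z0] := psi_socle sb gldim u; rewrite /soc_dim.
suff -> : socle e J (cosyz (cP e u) (idim u)) (psi u) = <[z]>%VS.
  by rewrite dim_vline z0.
apply/vspaceP=> y; apply/idP/vlineP => [ys|[c ->]]; last exact: memvZ.
exact/vlineP/(idim_socle_line sb cA_summand cA_vanish zs ys z0).
Qed.

Lemma soc_euler_psi u j : (forall t, psi t = j -> idim u <= idim t)%N ->
  soc_euler e J (cP e u) D.+1 j = (-1) ^+ idim u *+ (j == psi u).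
Proof.
move=> le_u; have uD : (idim u < D.+1)%N.
  by rewrite ltnS /idim; case: ex_minnP => m _; apply; rewrite cosyz_gldim0.
rewrite /soc_euler (bigD1 (Ordinal uD)) //= big1 ?addr0 => [|k ku].
  case: eqP => [->|ju]; first by rewrite soc_dim_last mulr1.
  rewrite (_ : soc_dim _ _ _ _ = 0%N) ?mulr0 //; apply/eqP; apply: contra_notT ju.
  by case/socle_psi_last.
rewrite (_ : soc_dim _ _ _ _ = 0%N) ?mulr0 //; apply/eqP; apply: contraNT ku.
by case/socle_psi_last => // kE _; apply/eqP/val_inj.
Qed.

End Triangular.
End Assembly.

Lemma regular_coresolution (K : fieldType) (A : falgType K) n (e : 'I_n -> A)
    (J : {vspace A}) : split_basic e J -> auslander_regular A ->
  exists (cA : coresolution A) (D : nat),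
  [/\ forall t, exists (i : 'Hom(idealmod (e t), cosyz cA 0))
          (p : 'Hom(cosyz cA 0, idealmod (e t))),
        [/\ rhom i, rhom p & (p \o i)%VF = \1%VF],
      forall k, ext_vanish (cterm cA k) k & forall X : rmod A, ext_vanish X D].
Proof.
move=> sb [[[I [eta [del [mI pdI]]]] _] [D gldim]].
have [cA cA0 cAE] := coresolution_of mI; exists cA, D; split=> [t|k|X].
- rewrite cA0; exists (ideal_incl e t), (ideal_proj e t).
  split; [exact: ideal_incl_hom | exact: ideal_proj_hom | exact: (ideal_projK sb)].
- by rewrite cAE; apply/pdim_ext_vanish/pdI.
- exact/pdim_ext_vanish/gldim.
Qed.

Theorem theorem3p13 (R : realType) (K : fieldType) (A : falgType K)
    (n : nat) (Q : quiver n) (qA : quiver_algebra Q A)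
    (Areg : auslander_regular A) (Aadm : admissible_order qA) :
  exists2 s : 'S_n, grade_perm qA s &
  exists2 U2 : 'M[R]_n,
    bruhat_decomposition (map_mx intr (coxeter_mx qA))
      1%:M (mx_of_perm R s) U2 &
    forall i : 'I_n, U2 i i = 1 \/ U2 i i = -1.
Proof.
have sb := quiver_split_basic qA.
have [cA [D [cA_summand cA_vanish gldim]]] := regular_coresolution sb Areg.
pose psi := psi sb gldim; pose d := idim (idem qA) gldim.
have psiI : injective psi := @psi_inj _ _ _ _ _ sb cA D cA_summand cA_vanish gldim.
pose s : 'S_n := (perm psiI)^-1%g.
have psi_s i : psi (s i) = i by rewrite -[psi _](permE psiI) permKV.
have gradeE i : grade (simple_at qA i) = Some (d (s i)).
  have [x xS] := ideal_top sb i; rewrite -{1}(psi_s i) in xS.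
  exact: (grade_simple cA_summand cA_vanish xS).
exists s => [i|].
  exists (d (s i)); split; first exact: gradeE.
  have [x xS] := ideal_top sb i; rewrite -{1}(psi_s i) in xS.
  have [y0 [y0_neq0 y0_e] [y0_line ess_y0]] := ext_socle cA_summand cA_vanish xS.
  have [z zS] := dual_top sb y0_neq0 y0_e y0_line ess_y0.
  have [y yS] := ideal_top sb (s i).
  exact: simple_iso zS yS.
have cartE : cartan_mx qA = cart (idem qA).
  by apply/matrixP=> i j; rewrite !mxE (dimv_ideal sb).
have coxE i j : coxeter_mx qA i j = - soc_euler (idem qA) (arrow_ideal qA)
    (cP (idem qA) i) D.+1 j.
  by rewrite /coxeter_mx cartE (coxeter_euler sb gldim) !mxE.
have cox_unit : coxeter_mx qA \in unitmx.
  rewrite /coxeter_mx -scaleN1r unitmxZ ?unitrN1 // unitmx_mul unitmx_tr unitmx_inv.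
  by rewrite cartE (cart_unit sb gldim).
have cox_s (i j : 'I_n) : (j <= i)%N ->
    coxeter_mx qA (s i) j = - ((-1) ^+ d (s i) *+ (j == i)).
  move=> ji; rewrite coxE (soc_euler_psi (sb := sb) cA_summand cA_vanish (gldim
    := gldim)).
    by rewrite -/psi psi_s.
  move=> t; rewrite -/psi -/d => tj.
  (* For [j < i], a strictly smaller grade at [j] than at [i] would force [i < j] by
     admissibility. *)
  have -> : t = s j by apply: (psiI); rewrite psi_s.
  move: ji; rewrite leq_eqVlt => /orP [/eqP/val_inj -> //|ji].
  rewrite leqNgt; apply/negP=> lt_d; have := Aadm j i.
  rewrite !gradeE /= lt_d => /(_ isT); by rewrite ltnNge ltnW.
pose C : 'M[R]_n := map_mx intr (coxeter_mx qA).
have U2E i j : (perm_mx s *m C) i j = (coxeter_mx qA (s i) j)%:~R.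
  by rewrite -row_permE !mxE.
(* The inverse of [mx_of_perm R s] is [perm_mx s], so [U2] is forced; its row [i] is row [s i] of
   the Coxeter matrix. *)
exists (perm_mx s *m C); last first.
  move=> i; rewrite U2E cox_s // eqxx mulr1n rmorphN rmorphXn rmorphN1 /=.
  by rewrite -signr_odd; case: (odd _); rewrite ?opprK; [left | right].
split.
- rewrite unitmxE det_map_mx; exact: rmorph_unit.
- by rewrite mul1mx /mx_of_perm mulmxA tr_perm_mx -perm_mxM mulVg perm_mx1 mul1mx.
- by apply/existsP; exists (s^-1)%g; rewrite /mx_of_perm tr_perm_mx.
- by move=> i j ji; rewrite mxE -val_eqE /= gtn_eqF.
- by move=> i j ji; rewrite U2E cox_s ?(ltnW ji) // -val_eqE /= ltn_eqF.
Qed.
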